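(* Let $T,R>0$, $\alpha>1$, $\lambda,\mu>0$. For a goal $\theta\ge0$ let $x_\theta(T)$ be the final progress of the agent (defined in the context) under the generalized hyperbolic discount function $\gamma_t(s)=(1+\lambda(s-t))^{-\mu/\lambda}$. Consider the case where exploitative rewards are allowed, i.e. the problem of finding $\theta^*\in\operatorname{argmax}_{\theta\ge0}x_\theta(T)$. With $f_T,\eta,t_0$ as in the context, define $$g(t):=f_T(t)^{-\frac1\alpha}\left(1-\exp\left(-\left(\frac{\mu}{\alpha-1}+\lambda\right)\eta(t)\right)\right),$$ and, when $t_0>0$, let $\tau^*\in\operatorname{argmax}_{\tau\in[0,t_0]}g(\tau)$ (a maximizer exists since $g$ is continuous on $[0,t_0]$). Then: (a) When $t_0\le0$, $\theta^*=R^{\frac1\alpha}f_T(0)^{-\frac1\alpha}$ is optimal and the corresponding final progress is $x_{\theta^*}(T)=\theta^*$. (b) When $t_0>0$ and $f_T(t_0)^{-\frac1\alpha}\ge g(\tau^* )$, $\theta^*=R^{\frac1\alpha}f_T(t_0)^{-\frac1\alpha}$ is optimal and $x_{\theta^*}(T)=\theta^*$. (c) When $t_0>0$ and $f_T(t_0)^{-\frac1\alpha}<g(\tau^* )$, $\theta^*=R^{\frac1\alpha}f_T(\tau^* )^{-\frac1\alpha}$ is optimal and $x_{\theta^*}(T)=R^{\frac1\alpha}g(\tau^* )$.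
   Context: Agent model. Cost function: $c(\Delta)=\Delta^\alpha$ if $\Delta\ge0$ and $c(\Delta)=+\infty$ if $\Delta<0$. For $t\in[0,T)$ and $x\ge0$, $\mathcal Y_{t,x}$ is the set of absolutely continuous functions $y:[t,T]\to\mathbb R$ with $y(t)=x$. The perceived cost of $y\in\mathcal Y_{t,x}$ is $$\mathcal P[y]=\int_t^T\gamma_t(s)\,c(y'(s))\,ds-\gamma_t(T)\,R\cdot\mathbf 1[y(T)\ge\theta].$$ Let $y^*_{t,x}$ be a minimizer of $\mathcal P$ over $\mathcal Y_{t,x}$; if the minimizer is not unique, one with the largest initial derivative $\frac{d}{ds}y(s)\big|_{s=t}$ is chosen. The agent's trajectory for goal $\theta$ is the absolutely continuous function $x_\theta:[0,T]\to\mathbb R$ with $x_\theta(0)=0$ and $x_\theta'(t)=\frac{d}{ds}y^*_{t,x_\theta(t)}(s)\big|_{s=t}$ for almost every $t\in[0,T]$. For $t\in[0,T)$, $$\eta(t):=\int_0^t\frac{ds}{\bigl(1+\lambda(T-s)\bigr)^{\frac{\mu}{\lambda(\alpha-1)}+1}-1},$$ $$f_T(t):=\left(\frac{\mu+\lambda(\alpha-1)}{(\alpha-1)\left[\bigl(1+\lambda(T-t)\bigr)^{\frac{\mu}{\lambda(\alpha-1)}+1}-1\right]}\right)^{\alpha-1}\bigl(1+\lambda(T-t)\bigr)^{\frac{\mu}{\lambda}}\exp\left(-\alpha\left(\frac{\mu}{\alpha-1}+\lambda\right)\eta(t)\right).$$ $x_0$ denotes the unique real solution with $x>1$ of $$(\alpha-1)x^{\frac{\mu}{\lambda}+\alpha-1}-\alpha\left(\frac{\mu}{\lambda(\alpha-1)}+1\right)x^{\alpha-1}+\frac{\mu}{\lambda}=0,$$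 and $t_0:=T-\frac{x_0^{\alpha-1}-1}{\lambda}$.
   Formalization: The agent's trajectory is taken to be the pointwise greatest absolutely continuous solution of the almost-everywhere equation; at θ* of (a), (b) that equation has a second solution (giving up at max(t0,0)), so ''the'' trajectory is otherwise not unique. *)

(* Defs.v *)
From HB Require Import structures.
From mathcomp Require Import all_boot all_order all_algebra.
From mathcomp Require Import all_classical all_reals all_analysis.
Set Implicit Arguments.
Unset Strict Implicit.
Unset Printing Implicit Defensive.
Import Order.TTheory GRing.Theory Num.Theory.
Import numFieldNormedType.Exports.
Local Open Scope classical_set_scope.
Local Open Scope ring_scope.

(* Functions on [a, b] are represented by total functions R -> R of which only
   the values on [a, b] matter. *)
Definition absolutely_continuous (R : realType) (a b : R) (f : R -> R) : Prop :=
  forall e : R, 0 < e -> exists2 d : R, 0 < d &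
    forall (n : nat) (u v : 'I_n -> R),
      (forall i, a <= u i /\ u i <= v i /\ v i <= b) ->
      (forall i j, i != j -> v i <= u j \/ v j <= u i) ->
      \sum_(i < n) (v i - u i) < d ->
      \sum_(i < n) `|f (v i) - f (u i)| < e.

Definition cost (R : realType) (alpha d : R) : \bar R :=
  if 0 <= d then (d `^ alpha)%:E else +oo%E.

(* The derivative is the library's total one; an absolutely continuous y is
   differentiable almost everywhere, so default values do not contribute. *)
Definition perceived_cost (R : realType) (T rew alpha : R) (gamma : R -> R -> R)
    (theta t : R) (y : R -> R) : \bar R :=
  (\int[lebesgue_measure]_(s in `[t, T])
      ((gamma t s)%:E * cost alpha (derive1 y s))
   - (if theta <= y T then gamma t T * rew else 0)%:E)%E.

Definition admissible (R : realType) (T t x : R) (y : R -> R) : Prop :=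
  absolutely_continuous t T y /\ y t = x.

Definition perceived_minimizer (R : realType) (T rew alpha : R)
    (gamma : R -> R -> R) (theta t x : R) (y : R -> R) : Prop :=
  admissible T t x y /\
  forall z : R -> R, admissible T t x z ->
    (perceived_cost T rew alpha gamma theta t y
       <= perceived_cost T rew alpha gamma theta t z)%E.

(* A path starting at t lives on [t, T], so its derivative at t is one-sided. *)
Definition has_initial_derivative (R : realType) (y : R -> R) (t v : R) : Prop :=
  (y (t + h) - y t) / h @[h --> 0^'+] --> v.

Definition planned_path (R : realType) (T rew alpha : R) (gamma : R -> R -> R)
    (theta t x : R) (y : R -> R) (v : R) : Prop :=
  [/\ perceived_minimizer T rew alpha gamma theta t x y,
      has_initial_derivative y t v &
      forall (z : R -> R) (w : R),
        perceived_minimizer T rew alpha gamma theta t x z ->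
        has_initial_derivative z t w -> w <= v].

Definition follows_plan (R : realType) (T rew alpha : R) (gamma : R -> R -> R)
    (theta : R) (x : R -> R) : Prop :=
  [/\ absolutely_continuous 0 T x, x 0 = 0 &
      {ae lebesgue_measure, forall t : R, t \in `[0, T] ->
         exists (y : R -> R) (v : R),
           planned_path T rew alpha gamma theta t (x t) y v /\
           is_derive t 1 x v}].

(* For an exceptional goal, an indifference between continuing and giving up
   can occur at a single instant.  The almost-everywhere equation then has two
   solutions, one for each decision at that instant; the tie-breaking rule
   (largest derivative) selects the greatest one.  This makes the trajectory
   unique on [0, T]. *)
Definition agent_trajectory (R : realType) (T rew alpha : R)
    (gamma : R -> R -> R) (theta : R) (x : R -> R) : Prop :=
  follows_plan T rew alpha gamma theta x /\
  forall z : R -> R, follows_plan T rew alpha gamma theta z ->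
    forall t : R, t \in `[0, T] -> z t <= x t.

(* X theta is the trajectory for the goal theta. *)
Definition optimal_goal (R : realType) (T : R) (X : R -> R -> R) (theta : R) :
    Prop :=
  0 <= theta /\ forall theta' : R, 0 <= theta' -> X theta' T <= X theta T.

Definition is_argmax (R : realType) (A : set R) (h : R -> R) (tau : R) : Prop :=
  A tau /\ forall s : R, A s -> h s <= h tau.

Definition hyperbolic_discount (R : realType) (lambda mu t s : R) : R :=
  (1 + lambda * (s - t)) `^ (- (mu / lambda)).

Definition eta (R : realType) (T alpha lambda mu t : R) : R :=
  \int[lebesgue_measure]_(s in `[0, t])
    ((1 + lambda * (T - s)) `^ (mu / (lambda * (alpha - 1)) + 1) - 1)^-1.

Definition fT (R : realType) (T alpha lambda mu t : R) : R :=
  ((mu + lambda * (alpha - 1)) /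
   ((alpha - 1) *
    ((1 + lambda * (T - t)) `^ (mu / (lambda * (alpha - 1)) + 1) - 1)))
    `^ (alpha - 1)
  * (1 + lambda * (T - t)) `^ (mu / lambda)
  * expR (- (alpha * (mu / (alpha - 1) + lambda) * eta T alpha lambda mu t)).

Definition gT (R : realType) (T alpha lambda mu t : R) : R :=
  fT T alpha lambda mu t `^ (- alpha^-1)
  * (1 - expR (- ((mu / (alpha - 1) + lambda) * eta T alpha lambda mu t))).

Definition is_x0 (R : realType) (alpha lambda mu x : R) : Prop :=
  1 < x /\
  (alpha - 1) * x `^ (mu / lambda + alpha - 1)
  - alpha * (mu / (lambda * (alpha - 1)) + 1) * x `^ (alpha - 1)
  + mu / lambda = 0.

Definition time0 (R : realType) (T alpha lambda x0 : R) : R :=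
  T - (x0 `^ (alpha - 1) - 1) / lambda.

(* Main.v *)
(* The paths of least perceived cost are found by the tangent inequality for
   [x `^ alpha] (Euler-Lagrange), once an absolutely continuous function is known
   to be the integral of its derivative: its total variation defines a
   Lebesgue-Stieltjes measure dominated by the Lebesgue measure, so Radon-Nikodym
   and Lebesgue differentiation apply.  Hence at time [t], with a distance [d]
   left, the agent either stops or moves at speed [d / G(t)], [G] being
   [profile (T - t)], and he moves iff [d `^ alpha <= rew * threshold t].  The
   distance of an agent who always moves is [theta * decay t], and the condition
   becomes [theta `^ alpha * f t <= rew].  Since [threshold] is nonincreasing, an
   agent who stops never resumes, so his trajectory is determined by the time
   [quit_time] at which [theta `^ alpha * f] first exceeds [rew], and his final
   progress is [theta * (1 - decay quit_time)].  The function [f] increases up to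
   [t0] and decreases afterwards, because its logarithmic derivative has the sign
   of a convex function of [1 + lambda * (T - t)] vanishing at [x0 `^ (alpha - 1)].
   Goals with [theta `^ alpha * max f <= rew] are reached; for larger ones
   [quit_time] lies between [0] and [t0], and the progress there is
   [rew `^ alpha^-1 * g quit_time]. *)
Require Import Defs.
From HB Require Import structures.
From mathcomp Require Import all_boot all_order all_algebra.
From mathcomp Require Import all_classical all_reals all_analysis.
From mathcomp Require Import measurable_realfun.
From mathcomp Require Import ring lra.

Set Implicit Arguments.
Unset Strict Implicit.
Unset Printing Implicit Defensive.
Import Order.TTheory GRing.Theory Num.Theory.
Import numFieldNormedType.Exports.
Local Open Scope classical_set_scope.
Local Open Scope ring_scope.

(** * Absolutely continuous functions *)

(** The speed prescribed by the plans jumps, as a function of the position, where the agent is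
    indifferent, and the equation holds only almost everywhere, so no uniqueness theorem for
    differential equations applies. A follower of the plans is compared with explicit curves
    instead: while it moves, its speed decreases with its position, so once ahead of the path of an
    agent who never gives up it cannot gain on it. This one-sided comparison reads monotonicity off
    an almost everywhere sign of the derivative, which fails for singular functions such as
    Cantor's; hence the need for densities of absolutely continuous functions. The same densities
    give a measurable substitute for the derivative of a competing path. The other obstacle is the
    final time: [eta] diverges at [T], and absolute continuity up to [T] of the path that is never
    abandoned rests on bounding [decay t] by a multiple of [profile (T - t)]. *)

Section chains.
Context {R : realType}.
Implicit Types (a b u v e : R) (f : R -> R) (s : seq (R * R)).

Definition itv_chain s := pairwise (fun x y : R * R => x.2 <= y.1) s.

Definition sub_itvs a b s :=
  all (fun x : R * R => [&& a <= x.1, x.1 <= x.2 & x.2 <= b]) s.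

Definition chain_length s := \sum_(x <- s) (x.2 - x.1).

Definition chain_var f s := \sum_(x <- s) `|f x.2 - f x.1|.

(** Absolute continuity tested on ordered lists instead of families indexed by ['I_n]: lists can be
    concatenated and refined by induction, and a partition yields one directly. *)
Definition chain_ac a b f := forall e, 0 < e -> exists2 d, 0 < d &
  forall s, itv_chain s -> sub_itvs a b s -> chain_length s < d ->
  chain_var f s < e.

Lemma ac_chain_ac a b f : absolutely_continuous a b f -> chain_ac a b f.
Proof.
move=> acf e e0; have [d d0 H] := acf _ e0; exists d => // s cs ss sd.
have mem (i : 'I_(size s)) : nth (a, a) s i \in s by rewrite mem_nth.
have := H (size s) (fun i => (nth (a, a) s i).1) (fun i => (nth (a, a) s i).2).
rewrite /chain_length (big_nth (a, a)) big_mkord in sd.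
rewrite /chain_var (big_nth (a, a)) big_mkord; apply => //.
- by move=> i; move/allP: ss => /(_ _ (mem i)) /and3P[].
- move=> i j ij; move: cs => /(pairwiseP (a, a)) cs.
  have [lij|lji|/val_inj E] := ltngtP i j; last by rewrite E eqxx in ij.
  + by left; apply: cs; rewrite ?inE.
  + by right; apply: cs; rewrite ?inE.
Qed.

Lemma partition_chain u v f l : itv_partition u v l ->
  let t := zip (u :: l) l in
  [/\ itv_chain t, sub_itvs u v t, chain_length t = v - u &
      chain_var f t = variation u v f l].
Proof.
elim: l u => [u /itv_partition_nil -> | h l ih u] /=.
  by rewrite /chain_length /chain_var /variation !big_nil subrr.
move=> uvl; have /= [uh _] := uvl; move/andP: uh => [uh _].
have hvl := itv_partition_cons uvl; have [c1 c2 c3 c4] := ih _ hvl.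
have hv := itv_partition_le hvl.
have hle : all (fun x : R * R => h <= x.1) (zip (h :: l) l).
  by apply: sub_all c2 => x /and3P[].
split.
- by rewrite /itv_chain /= hle.
- rewrite /sub_itvs /= lexx (ltW uh) hv /=.
  apply: sub_all c2 => x /and3P[hx -> ->]; rewrite !andbT.
  by rewrite (le_trans (ltW uh)).
- by rewrite /chain_length big_cons /= -/(chain_length _) c3; lra.
- rewrite /chain_var big_cons /= -/(chain_var _ _) c4.
  by rewrite /variation [in RHS]/= big_nat_recl.
Qed.

Lemma total_variation_chain u v f e : u <= v ->
  total_variation u v f \is a fin_num -> 0 < e ->
  exists t, [/\ itv_chain t, sub_itvs u v t, chain_length t = v - u &
    (total_variation u v f <= (chain_var f t + e)%:E)%E].
Proof.
move=> uv tvfin e0.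
have [_ [_ [l uvl <-] <-] lt] := ub_ereal_sup_adherent e0 tvfin.
have /= [c1 c2 c3 c4] := partition_chain f uvl.
exists (zip (u :: l) l); split => //; rewrite c4 EFinD -leeBlDr//.
exact: ltW.
Qed.

Lemma sub_itvsS a b u v s : a <= u -> v <= b -> sub_itvs u v s ->
  sub_itvs a b s.
Proof.
move=> au vb; apply: sub_all => x /and3P[ux -> xv].
by rewrite (le_trans au ux) (le_trans xv vb).
Qed.

(** Each interval is replaced by a near-optimal partition of itself, which keeps the total length.
    The last clause is the induction invariant: it keeps the new intervals of the tail to the right
    of those of the head, so that the concatenation is again a chain. *)
Lemma chain_refine a b f s e : itv_chain s -> sub_itvs a b s ->
  total_variation a b f \is a fin_num -> 0 < e ->
  exists t, [/\ itv_chain t, sub_itvs a b t,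
    chain_length t = chain_length s,
    (\sum_(x <- s) fine (total_variation x.1 x.2 f) <= chain_var f t + e) &
    {in t, forall y, exists2 x, x \in s & x.1 <= y.1}].
Proof.
move=> + + tvfin; elim: s e => [e _ _ e0|x s ih e].
  exists [::]; split => //; rewrite /chain_var !big_nil; lra.
rewrite /itv_chain /= => /andP[xs cs] /andP[/and3P[ax x12 xb] ss] e0.
have e20 : 0 < e / 2 by rewrite divr_gt0.
have [t [t1 t2 t3 t4 t5]] := ih (e / 2) cs ss e20.
have xfin : total_variation x.1 x.2 f \is a fin_num.
  apply/bounded_variationP => //.
  apply: (bounded_variationl x12 xb).
  apply: (bounded_variationr ax (le_trans x12 xb)).
  by apply/bounded_variationP => //; apply: le_trans ax (le_trans x12 xb).
have [r [r1 r2 r3 r4]] := total_variation_chain x12 xfin e20.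
exists (r ++ t); split.
- rewrite /itv_chain pairwise_cat; apply/and3P; split => //.
  apply/allrelP => y z yr zt; have [w ws wz] := t5 _ zt.
  move/allP: r2 => /(_ _ yr)/and3P[_ _ yx].
  by move/allP: xs => /(_ _ ws) xw; apply: le_trans yx (le_trans xw wz).
- by rewrite /sub_itvs all_cat -!/(sub_itvs _ _ _) t2 (sub_itvsS ax xb r2).
- by rewrite /chain_length big_cat big_cons -!/(chain_length _) /= r3 t3.
- rewrite /chain_var big_cat big_cons -!/(chain_var _ _) /=.
  have : fine (total_variation x.1 x.2 f) <= chain_var f r + e / 2.
    by rewrite -lee_fin fineK.
  lra.
- move=> y; rewrite mem_cat => /orP[yr|/t5[w ws wy]].
    by exists x; rewrite ?inE ?eqxx//; move/allP: r2 => /(_ _ yr)/and3P[].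
  by exists w; rewrite // inE ws orbT.
Qed.

(** Cut [[a, b]] into pieces shorter than the [d] that absolute continuity gives for [1]: on each
    piece the variation is at most [1]. *)
Lemma chain_ac_finite_variation a b f : a <= b -> chain_ac a b f ->
  total_variation a b f \is a fin_num.
Proof.
move=> ab acf; have [d d0 H] := acf 1 ltr01.
have step u v : a <= u -> u <= v -> v <= b -> v - u < d ->
    total_variation u v f \is a fin_num.
  move=> au uv vb uvd; apply/bounded_variationP => //.
  exists 1 => _ [l uvl <-]; have /= [c1 c2 c3 <-] := partition_chain f uvl.
  by apply/ltW/H => //; [exact: sub_itvsS c2|rewrite c3].
have [n nd] : exists n : nat, (b - a) / d < n.+1%:R.
  exists (Num.bound ((b - a) / d)); apply: lt_le_trans (_ : (Num.bound ((b - a) / d))%:R <= _).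
    by apply: archi_boundP; rewrite divr_ge0 ?subr_ge0// ltW.
  by rewrite ler_nat.
pose h := (b - a) / n.+1%:R.
have h0 : 0 <= h by rewrite divr_ge0// subr_ge0.
have hd : h < d by rewrite /h ltr_pdivrMr// mulrC -ltr_pdivrMr.
have hn : a + n.+1%:R * h = b by rewrite /h mulrC divfK ?pnatr_eq0//; lra.
suff : forall k, (k <= n.+1)%N -> total_variation a (a + k%:R * h) f \is a fin_num.
  by move/(_ n.+1 (leqnn _)); rewrite hn.
elim=> [_|k ih kn]; first by rewrite mul0r addr0 total_variationxx.
have ak : a <= a + k%:R * h by rewrite lerDl mulr_ge0.
have kk : a + k%:R * h <= a + k.+1%:R * h by rewrite lerD2l ler_wpM2r// ler_nat.
rewrite (total_variationD f ak kk) fin_numD ih ?(ltnW kn)//=; apply: step => //.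
  by rewrite -hn lerD2l ler_wpM2r// ler_nat.
by rewrite -natr1 mulrDl mul1r; lra.
Qed.

End chains.

(** * Stieltjes measures of absolutely continuous functions *)

Section stieltjes.
Context {R : realType}.
Implicit Types (a b u v e : R) (s : seq (R * R)).
Notation mu := (@lebesgue_measure R).

(** Stated for a general [m] because it serves twice: for the Stieltjes measure of [F], and for the
    Lebesgue measure with [G] the identity. *)
Lemma measure_itv_chain (m : {measure set (measurableTypeR R) -> \bar R})
    (G : R -> R) a b s :
  (forall u v, u <= v -> m `]u, v]%classic = (G v - G u)%:E) ->
  itv_chain s -> sub_itvs a b s ->
  m (\big[setU/set0]_(x <- s) `]x.1, x.2]%classic) =
  (\sum_(x <- s) (G x.2 - G x.1))%:E.
Proof.
move=> mG; elim: s => [|x s ih]; first by rewrite !big_nil measure0.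
rewrite /itv_chain /= => /andP[xs cs] /andP[/and3P[ax x12 xb] ss].
rewrite !big_cons EFinD -ih// -mG// measureU//.
  by apply: bigsetU_measurable => y _; exact: measurable_itv.
rewrite -subset0 big_distrr/= => z; rewrite big_seq; elim/big_ind: _ => //.
- by move=> A B HA HB [].
- move=> y ys [] /=; rewrite !in_itv/= => /andP[_ zx] /andP[yz _].
  by have := le_lt_trans (le_trans zx (allP xs _ ys)) yz; rewrite ltxx.
Qed.

Lemma lebesgue_stieltjes_measure_itv_oc (F : cumulative R R) u v : u <= v ->
  lebesgue_stieltjes_measure F `]u, v]%classic = (F v - F u)%:E.
Proof.
move=> uv; rewrite /lebesgue_stieltjes_measure /measure_extension.
by rewrite measurable_mu_extE/= ?wlength_itv_bnd//; exact: is_ocitv.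
Qed.

(** An open set is in general an infinite union of intervals, whereas absolute continuity concerns
    finite chains. The grid cells contained in [U] form such a chain, and they catch every point
    around which [U] contains a ball larger than the mesh. *)
Lemma open_itv_chain a b (U : set R) n : a < b ->
  exists s, [/\ itv_chain s, sub_itvs a b s,
    \big[setU/set0]_(x <- s) `]x.1, x.2]%classic `<=` U &
    forall x r, x \in `]a, b] -> (b - a) / n.+1%:R < r -> ball x r `<=` U ->
      (\big[setU/set0]_(x <- s) `]x.1, x.2]%classic) x].
Proof.
move=> ab; pose h := (b - a) / n.+1%:R; pose c (k : nat) := a + k%:R * h.
have h0 : 0 < h by rewrite divr_gt0// subr_gt0.
have cn : c n.+1 = b by rewrite /c /h mulrC divfK ?pnatr_eq0//; lra.
have cle k l : (k <= l)%N -> c k <= c l.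
  by move=> kl; rewrite lerD2l ler_wpM2r ?(ltW h0)// ler_nat.
pose ok k := `[< `]c k, c k.+1]%classic `<=` U >].
pose s := [seq (c k, c k.+1) | k <- iota 0 n.+1 & ok k].
exists s; split.
- rewrite /itv_chain pairwise_map.
  have : pairwise ltn [seq k <- iota 0 n.+1 | ok k].
    by apply: pairwise_filter; rewrite -(sorted_pairwise ltn_trans) iota_ltn_sorted.
  by apply: sub_pairwise => k l /= kl; exact: cle.
- apply/allP => _ /mapP[k + ->]; rewrite mem_filter mem_iota => /and3P[_ _ kn] /=.
  rewrite -cn; apply/and3P; split; try exact: cle.
  by rewrite -[a]addr0 -[X in a + X](mul0r h) (cle 0%N).
- rewrite -bigcup_seq => x [_ /= /mapP[k + ->]]; rewrite mem_filter => /andP[/asboolP kU _].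
  exact: kU.
- move=> x r; rewrite in_itv/= => /andP[ax xb] hr xU.
  have [k [kn kx]] : exists k, (k < n.+1)%N /\ x \in `]c k, c k.+1].
    suff : forall m, x <= c m -> exists k, (k < m)%N /\ x \in `]c k, c k.+1].
      by move/(_ n.+1); rewrite cn => /(_ xb).
    elim=> [|m ih]; first by rewrite /c mul0r addr0 leNgt ax.
    move=> xm; have [/ih[k [km kx]]|mx] := leP x (c m).
      by exists k; split => //; exact: ltnW.
    by exists m; split => //; rewrite in_itv/= mx.
  rewrite -bigcup_seq; exists (c k, c k.+1) => //=.
  apply/mapP; exists k => //; rewrite mem_filter mem_iota /= kn andbT.
  apply/asboolP => y /=; rewrite in_itv/= => /andP[ky yk].
  apply: xU; rewrite /ball/=; move: kx hr; rewrite -/h in_itv/= => /andP[kx xk] hr.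
  move: ky yk kx xk; rewrite /c -natr1 mulrDl mul1r => ky yk kx xk.
  by rewrite ltr_distl; lra.
Qed.

(** By outer regularity [A] lies in an open set of Lebesgue measure less than [d]. Every grid chain
    inside it is shorter than [d], so its Stieltjes measure is at most [e], and each point of [A] in
    []a, b]] belongs to all chains of small enough mesh. *)
Lemma stieltjes_dominated (F : cumulative R R) a b : a < b ->
  chain_ac a b F ->
  forall A : set (measurableTypeR R), measurable A -> mu A = 0%E ->
  lebesgue_stieltjes_measure F (A `&` `]a, b]%classic) = 0%E.
Proof.
move=> ab acF A mA muA; set nu := lebesgue_stieltjes_measure F.
apply/eqP; rewrite eq_le measure_ge0 andbT; apply/lee_addgt0Pr => e e0.
rewrite add0e; have [d d0 H] := acF _ e0.
have muAoo : (mu A < +oo)%E by rewrite muA.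
have [U [oU AU muU]] := lebesgue_regularity_outer mA muAoo d0.
have {}muU : (mu U < d%:E)%E.
  have mUA : measurable (U `\` A) by apply: measurableD => //; exact: open_measurable.
  have -> : mu U = mu (U `\` A); last by [].
  rewrite -[RHS]adde0 -muA -[in LHS](setDKU AU).
  by apply: measureU => //; rewrite setDKI.
have [s Hs] := choice (fun n => open_itv_chain U n ab).
pose W n := \big[setU/set0]_(x <- s n) `]x.1, x.2]%classic.
have mW n : measurable (W n).
  by apply: bigsetU_measurable => y _; exact: measurable_itv.
have nuW n : (nu (W n) <= e%:E)%E.
  have [s1 s2 s3 _] := Hs n.
  have -> : nu (W n) = (\sum_(x <- s n) (F x.2 - F x.1))%:E.
    exact: measure_itv_chain (lebesgue_stieltjes_measure_itv_oc F) s1 s2.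
  rewrite lee_fin.
  apply: (@le_trans _ _ (chain_var F (s n))).
    by apply: ler_sum => x _; exact: ler_norm.
  apply/ltW/H => //; rewrite -lte_fin; apply: le_lt_trans muU.
  have -> : (chain_length (s n))%:E = mu (W n).
    apply/esym/(@measure_itv_chain mu idfun a b (s n)) => //.
    exact: lebesgue_stieltjes_measure_itv_oc.
  by apply: le_measure; rewrite ?inE//; [exact: mW|exact: open_measurable].
(* The grids are not nested, so [W] is not monotone; the intersections of its tails are, which
   permits continuity from below. *)
pose V n := \bigcap_(k in [set k | (n <= k)%N]) W k.
have mV n : measurable (V n) by exact: bigcap_measurableType.
have AV : A `&` `]a, b]%classic `<=` \bigcup_n V n.
  move=> x [Ax xab].
  have [r r0 xU] : exists2 r, 0 < r & ball x r `<=` U.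
    by have := oU _ (AU _ Ax) => /nbhs_ballP[r r0 ?]; exists r.
  exists (Num.bound ((b - a) / r)) => // k /= rk.
  have [_ _ _] := Hs k; apply; [exact: xab| |exact: xU].
  rewrite ltr_pdivrMr// mulrC -ltr_pdivrMr//.
  apply: (@lt_le_trans _ _ (Num.bound ((b - a) / r))%:R).
    by apply: archi_boundP; rewrite divr_ge0 ?subr_ge0// ltW.
  by rewrite ler_nat (leq_trans rk).
apply: (@le_trans _ _ (nu (\bigcup_n V n))).
  apply: le_measure; rewrite ?inE.
  - by apply: measurableI => //; exact: measurable_itv.
  - by apply: bigcup_measurable => k _; exact: mV.
  - exact: AV.
have : nu \o V @ \oo --> nu (\bigcup_n V n).
  apply: nondecreasing_cvg_mu => //.
    by apply: bigcup_measurable => k _; exact: mV.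
  move=> m n mn; apply/subsetPset => x Vx k /= nk; apply: Vx => /=.
  exact: leq_trans nk.
move=> /cvg_lim <-//; apply: lime_le.
  apply: ereal_nondecreasing_is_cvgn => m n mn; apply: le_measure.
  - by rewrite inE; exact: mV.
  - by rewrite inE; exact: mV.
  - by move=> x Vx k /= nk; apply: Vx => /=; exact: leq_trans nk.
apply: nearW => n /=; apply: le_trans (nuW n).
apply: le_measure.
- by rewrite inE; exact: mV.
- by rewrite inE; exact: mW.
- by move=> x; apply => /=.
Qed.

End stieltjes.

(** * Densities of absolutely continuous functions *)

Section ac_density.
Context {R : realType}.
Implicit Types (a b u v e : R).
Notation mu := (@lebesgue_measure R).

Lemma nondecreasing_ac_density a b (F : R -> R) : a < b ->
  {in `[a, b] &, nondecreasing_fun F} -> chain_ac a b F ->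
  exists p : R -> R, mu.-integrable setT (EFin \o p) /\
    forall x, x \in `[a, b] -> F x - F a = \int[mu]_(t in `[a, x]) p t.
Proof.
move=> ab ndF acF.
(* A [cumulative] function is monotone and right continuous on the whole line, so [F] is extended by
   constants outside [[a, b]]. *)
pose clip x := Num.max a (Num.min x b).
have clip_itv x : clip x \in `[a, b].
  by rewrite in_itv/= /clip le_max lexx/= ge_max (ltW ab) ge_min lexx orbT.
have clip_id x : x \in `[a, b] -> clip x = x.
  by rewrite in_itv/= /clip => /andP[ax xb]; rewrite (min_idPl xb) (max_idPr ax).
have clip_le x y : x <= y -> clip x <= clip y.
  move=> xy; rewrite /clip ge_max !le_max lexx/=; apply/orP; right.
  by rewrite le_min !ge_min xy lexx orbT.
have clip_dist x y : x <= y -> clip y - clip x <= y - x.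
  move=> xy; rewrite /clip.
  case: (leP x b) => ?; case: (leP y b) => ?; case: (leP a x) => ?; case: (leP a y) => ?;
    case: (leP a b) => ?; lra.
pose F' := F \o clip.
have ndF' : nondecreasing_fun F' by move=> x y xy; apply: ndF => //; exact: clip_le.
have acF' : chain_ac a b F'.
  move=> e /acF[d d0 H]; exists d => // s s1 s2 s3.
  have -> : chain_var F' s = chain_var F s; last exact: H.
  rewrite /chain_var big_seq [RHS]big_seq; apply: eq_bigr => x xs.
  move/allP : s2 => /(_ _ xs)/and3P[ax x12 xb]; rewrite /F' /= !clip_id// in_itv/=.
  - by rewrite ax (le_trans x12).
  - by rewrite (le_trans ax).
have rcF' : right_continuous F'.
  apply: right_continuousW => x; apply/cvgrPdist_lt => e e0.
  have [d d0 H] := acF _ e0.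
  have key u v : u <= v -> v - u < d -> `|F' v - F' u| < e.
    move=> uv uvd; have := H [:: (clip u, clip v)] erefl.
    rewrite /sub_itvs /chain_length /chain_var /= !big_cons !big_nil !addr0 /=.
    apply; last by apply: le_lt_trans uvd; exact: clip_dist.
    move: (clip_itv u) (clip_itv v); rewrite !in_itv/= => /andP[-> _] /andP[_ ->].
    by rewrite clip_le.
  near=> y; have xyd : `|x - y| < d by near: y; apply: cvgr_dist_lt => //; exact: cvg_id.
  have [xy|/ltW yx] := leP x y.
    by rewrite distrC; apply: key => //; move: xyd; rewrite ltr_distl; lra.
  by apply: key => //; move: xyd; rewrite ltr_distl; lra.
pose F'' : cumulative R R := HB.pack F' (@isCumulative.Build R _ R F' ndF' rcF').
pose nu := lebesgue_stieltjes_measure F''.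
have nuab : (nu `]a, b]%classic < +oo)%E.
  by rewrite /nu lebesgue_stieltjes_measure_itv_oc ?(ltW ab)// ltry.
have mab : measurable (`]a, b]%classic : set (measurableTypeR R)).
  exact: measurable_itv.
pose nuD : {finite_measure set (measurableTypeR R) -> \bar R} := mfrestr mab nuab.
have dom : nuD `<< (mu : {sigma_finite_measure set (measurableTypeR R) -> \bar R}).
  apply/null_content_dominatesP => A mA muA.
  exact: (stieltjes_dominated (F := F'') ab).
have [f [f0 ffin intf Hf]] := radon_nikodym_sigma_finite dom.
exists (fine \o f).
have fE : EFin \o (fine \o f) = f by apply/funext => x /=; rewrite fineK.
rewrite fE; split => // x; rewrite in_itv/= => /andP[ax xb].
have : nuD `]a, x]%classic = (F x - F a)%:E.
  transitivity (nu (`]a, x]%classic `&` `]a, b]%classic)); first by [].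
  rewrite setIidl; last first.
    by move=> y /=; rewrite !in_itv/= => /andP[-> yx]/=; exact: le_trans xb.
  rewrite /nu lebesgue_stieltjes_measure_itv_oc//= /F' /=.
  by rewrite !clip_id// in_itv/= ?lexx ?(ltW ab)// ax.
rewrite Hf; last exact: measurable_itv.
move=> fx; rewrite /Rintegral.
rewrite -(@integral_itv_obnd_cbnd _ _ _ (EFin \o (fine \o f))); last first.
  rewrite fE; move/integrableP: intf => [mf _].
  exact: (measurable_funS measurableT (@subsetT _ _) mf).
have -> : (fun t => ((fine \o f) t)%:E) = f by exact: fE.
exact: (esym (congr1 fine fx)).
Unshelve. all: by end_near. Qed.

(** Refining a chain by [chain_refine] does not change its length, so the [d] that suits [f] at
    [e / 2] suits its variation function at [e]. *)
Lemma ac_chain_nonneg_variation a b (f : R -> R) : a <= b -> chain_ac a b f ->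
  chain_ac a b (fun x => fine (total_variation a x f)).
Proof.
move=> ab acf; have tvfin := chain_ac_finite_variation ab acf.
have tvfinx x y : a <= x -> x <= y -> y <= b -> total_variation x y f \is a fin_num.
  move=> ax xy yb; apply/bounded_variationP => //.
  apply: (bounded_variationl xy yb).
  apply: (bounded_variationr ax (le_trans xy yb)).
  exact/bounded_variationP.
move=> e e0; have e20 : 0 < e / 2 by rewrite divr_gt0.
have [d d0 H] := acf _ e20; exists d => // s s1 s2 s3.
have e40 : 0 < e / 2 / 2 by rewrite divr_gt0.
have [t [t1 t2 t3 t4 _]] := chain_refine s1 s2 tvfin e40.
have : chain_var f t < e / 2 by apply: H; rewrite ?t3.
suff -> : chain_var (fun x => fine (total_variation a x f)) s =
    \sum_(x <- s) fine (total_variation x.1 x.2 f) by lra.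
rewrite /chain_var big_seq [RHS]big_seq; apply: eq_bigr => x xs.
move/allP : s2 => /(_ _ xs)/and3P[ax x12 xb].
rewrite (total_variationD f ax x12) fineD ?tvfinx// ?(le_trans x12)//.
by rewrite addrC addKr ger0_norm// fine_ge0// total_variation_ge0.
Qed.

(** Jordan decomposition: [z] is the difference of [V] and [V \- z], both nondecreasing and
    absolutely continuous, so each has a density. *)
Theorem ac_density a b (z : R -> R) : a < b -> absolutely_continuous a b z ->
  exists p : R -> R, [/\ mu.-integrable setT (EFin \o p),
    forall x, x \in `[a, b] -> z x - z a = \int[mu]_(t in `[a, x]) p t &
    {ae mu, forall x, x \in `]a, b[ -> is_derive x 1 z (p x)}].
Proof.
move=> ab /ac_chain_ac acz; have ale := ltW ab.
pose V x := fine (total_variation a x z).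
have acV : chain_ac a b V := ac_chain_nonneg_variation ale acz.
have tvfin := chain_ac_finite_variation ale acz.
have tvfinx x y : a <= x -> x <= y -> y <= b -> total_variation x y z \is a fin_num.
  move=> ax xy yb; apply/bounded_variationP => //.
  apply: (bounded_variationl xy yb).
  apply: (bounded_variationr ax (le_trans xy yb)).
  exact/bounded_variationP.
have Vxy x y : x \in `[a, b] -> y \in `[a, b] -> x <= y -> `|z y - z x| <= V y - V x.
  rewrite !in_itv/= => /andP[ax xb] /andP[ay yb] xy.
  rewrite /V (total_variationD z ax xy) fineD ?tvfinx// [leRHS]addrC addKr.
  by rewrite -lee_fin fineK ?tvfinx// total_variation_ge.
have ndV : {in `[a, b] &, nondecreasing_fun V}.
  by move=> x y xab yab xy; rewrite -subr_ge0 (le_trans _ (Vxy _ _ xab yab xy)).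
have ndW : {in `[a, b] &, nondecreasing_fun (V \- z)}.
  move=> x y xab yab xy /=; have := Vxy _ _ xab yab xy.
  by rewrite ler_norml; lra.
have acW : chain_ac a b (V \- z).
  move=> e e0; have e20 : 0 < e / 2 by rewrite divr_gt0.
  have [d1 d10 H1] := acV _ e20; have [d2 d20 H2] := acz _ e20.
  exists (Num.min d1 d2); first by rewrite lt_min d10.
  move=> s s1 s2; rewrite lt_min => /andP[s3 s4].
  apply: (@le_lt_trans _ _ (chain_var V s + chain_var z s)).
    rewrite -big_split /=; apply: ler_sum => x _.
    apply: le_trans (ler_normB _ _); rewrite le_eqVlt; apply/orP; left.
    by apply/eqP; congr (`| _ |) => /=; lra.
  by rewrite [ltRHS](splitr e) ltrD// ?H1 ?H2.
have [p [intp Hp]] := nondecreasing_ac_density ab ndV acV.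
have [q [intq Hq]] := nondecreasing_ac_density ab ndW acW.
have intp' (A : set R) : measurable A -> mu.-integrable A (EFin \o p).
  by move=> mA; apply: integrableS intp.
have intq' (A : set R) : measurable A -> mu.-integrable A (EFin \o q).
  by move=> mA; apply: integrableS intq.
have intpq : mu.-integrable setT (EFin \o (p \- q)).
  rewrite (_ : _ \o _ = (EFin \o p) \- (EFin \o q))%E; last by apply/funext.
  exact: integrableB.
have Hz x : x \in `[a, b] -> z x - z a = \int[mu]_(t in `[a, x]) (p \- q) t.
  move=> xab; rewrite RintegralB//=; [|exact: intp'|exact: intq'].
  by rewrite -Hp// -Hq//=; lra.
exists (p \- q); split => //.
have locpq : locally_integrable [set: R] (p \- q).
  by apply: open_integrable_locally => //; exact: openT.
have intpqy y : mu.-integrable `[a, y] (EFin \o (p \- q)).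
  by apply: integrableS intpq.
have := @FTC1 R (p \- q) (BLeft a) intpqy locpq.
apply: filterS; first exact: (ae_filter_ringOfSetsType mu).
move=> x H xab.
have [|dF F'] := H; first by move: xab; rewrite in_itv/= lte_fin => /andP[].
apply: (@near_eq_is_derive _ _ _
  (fun x => z a + \int[mu]_(t in [set` Interval (BLeft a) (BRight x)]) (p \- q) t)).
- near=> y; rewrite -Hz; first lra.
  apply: subset_itv_oo_cc; near: y; apply: near_in_itvoo; exact: xab.
- rewrite -[X in is_derive _ _ _ X]add0r; apply: is_deriveD.
  by split; [exact: dF|rewrite -derive1E].
Unshelve. all: by end_near. Qed.

End ac_density.

(** * Monotonicity from almost everywhere derivatives *)

Section ac_lemmas.
Context {R : realType}.
Implicit Types (a b u v e : R) (f g z : R -> R).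
Notation mu := (@lebesgue_measure R).

Lemma lipschitz_ac a b f L : 0 <= L ->
  (forall u v, a <= u -> u <= v -> v <= b -> `|f v - f u| <= L * (v - u)) ->
  absolutely_continuous a b f.
Proof.
move=> L0 Lf e e0; have L1 : 0 < L + 1 by lra.
exists (e / (L + 1)); first by rewrite divr_gt0.
move=> n u v uv _; rewrite ltr_pdivlMr// => suv.
apply: le_lt_trans suv; rewrite mulrC mulr_sumr; apply: ler_sum => i _.
have [au [uvi vb]] := uv i; apply: le_trans (Lf _ _ au uvi vb) _.
by apply: ler_wpM2r; lra.
Qed.

Lemma acN a b f : absolutely_continuous a b f ->
  absolutely_continuous a b (\- f).
Proof.
move=> acf e /acf[d d0 H]; exists d => // n u v uv disj suv.
apply: le_lt_trans (H n u v uv disj suv); apply: ler_sum => i _ /=.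
by rewrite -opprD normrN.
Qed.

Lemma acD a b f g : absolutely_continuous a b f ->
  absolutely_continuous a b g -> absolutely_continuous a b (f \+ g).
Proof.
move=> acf acg e e0; have e20 : 0 < e / 2 by rewrite divr_gt0.
have [d1 d10 H1] := acf _ e20; have [d2 d20 H2] := acg _ e20.
exists (Num.min d1 d2); first by rewrite lt_min d10.
move=> n u v uv disj; rewrite lt_min => /andP[s1 s2].
apply: (@le_lt_trans _ _ (\sum_(i < n) `|f (v i) - f (u i)|
                        + \sum_(i < n) `|g (v i) - g (u i)|)).
  rewrite -big_split/=; apply: ler_sum => i _.
  by rewrite opprD addrACA; exact: ler_normD.
by rewrite [ltRHS](splitr e) ltrD// ?H1 ?H2.
Qed.

Lemma acW a b u v f : a <= u -> v <= b ->
  absolutely_continuous a b f -> absolutely_continuous u v f.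
Proof.
move=> au vb acf e /acf[d d0 H]; exists d => // n u' v' uv.
apply: H => i; have [ui [? vi]] := uv i; split; first exact: le_trans ui.
by split => //; exact: le_trans vb.
Qed.

Lemma ac_cst a b (c : R) : absolutely_continuous a b (cst c).
Proof.
apply: (@lipschitz_ac _ _ _ 0) => // u v _ _ _.
by rewrite subrr normr0 mul0r.
Qed.

Lemma ac_uniform a b f : absolutely_continuous a b f ->
  forall e, 0 < e -> exists2 d, 0 < d & forall u v, u \in `[a, b] ->
    v \in `[a, b] -> `|u - v| < d -> `|f u - f v| < e.
Proof.
move=> /ac_chain_ac acf e e0; have [d d0 H] := acf _ e0; exists d => // u v.
have key x y : x \in `[a, b] -> y \in `[a, b] -> x <= y -> `|x - y| < d ->
    `|f x - f y| < e.
  rewrite !in_itv/= => /andP[ax xb] /andP[ay yb] xy xyd.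
  have := H [:: (x, y)] erefl.
  rewrite /sub_itvs /chain_length /chain_var /= !big_cons !big_nil !addr0 /=.
  rewrite ax yb xy distrC; apply => //.
  by move: xyd; rewrite distrC ger0_norm// subr_ge0.
move=> uab vab; have [uv|/ltW vu] := leP u v; first exact: key.
by rewrite distrC [`|f u - _|]distrC; exact: key.
Qed.

Lemma ac_continuous a b f : absolutely_continuous a b f ->
  {within `[a, b], continuous f}.
Proof.
move=> /ac_uniform acf; apply/subspace_continuousP => x xab.
apply/cvgrPdist_lt => e /acf[d d0 H].
rewrite near_withinE; near=> y => yab; apply: H => //.
Unshelve. all: by end_near. Qed.

(** With the derivative known only almost everywhere, the mean value theorem is out of reach; the
    increment is the integral of the density, which agrees almost everywhere with its positive
    part. *)
Lemma ac_nondecreasing a b f : absolutely_continuous a b f ->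
  {ae mu, forall x, x \in `]a, b[ -> exists2 d, 0 <= d & is_derive x 1 f d} ->
  {in `[a, b] &, nondecreasing_fun f}.
Proof.
move=> acf f'0 u v; rewrite !in_itv/= => /andP[au ub] /andP[av vb].
rewrite le_eqVlt => /predU1P[->//|uv].
have [p [intp Hp Hd]] := ac_density uv (acW au vb acf).
rewrite -subr_ge0 Hp ?in_itv/= ?lexx ?(ltW uv)//.
rewrite -Rintegral_itv_bndo_bndc; last first.
  by apply: integrableS intp.
rewrite -Rintegral_itv_obnd_cbnd; last first.
  by apply: integrableS intp.
rewrite /Rintegral.
have -> : (\int[mu]_(x in `]u, v[) (p x)%:E =
    \int[mu]_(x in `]u, v[) (Num.max 0 (p x))%:E)%E.
  have mp : measurable_fun (`]u, v[%classic : set R) p.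
    apply: measurable_funTS; apply/measurable_EFinP.
    by case/integrableP: intp.
  apply: ae_eq_integral => //.
  - exact/measurable_EFinP.
  - by apply/measurable_EFinP; exact: measurable_maxr.
  have := f'0; apply: filterS2 Hd; first exact: (ae_filter_ringOfSetsType mu).
  move=> x Hpx Hdx /=; rewrite /= in_itv/= => /andP[ux xv].
  have [|d d0 fd] := Hdx.
    by rewrite in_itv/= (le_lt_trans au ux) (lt_le_trans xv vb).
  have [|_ <-] := Hpx; first by rewrite in_itv/= ux.
  by case: fd => _ ->; rewrite (max_idPr d0).
by apply: fine_ge0; apply: integral_ge0 => x _; rewrite lee_fin le_max lexx.
Qed.

Lemma ac_constant a b f : absolutely_continuous a b f ->
  {ae mu, forall x, x \in `]a, b[ -> is_derive x 1 f 0} ->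
  {in `[a, b] &, forall x y, f x = f y}.
Proof.
move=> acf f'0.
have H1 : {in `[a, b] &, nondecreasing_fun f}.
  apply: ac_nondecreasing acf _; apply: filterS f'0.
    exact: (ae_filter_ringOfSetsType mu).
  by move=> x H /H; exists 0.
have H2 : {in `[a, b] &, nondecreasing_fun (\- f)}.
  apply: ac_nondecreasing (acN acf) _; apply: filterS f'0.
    exact: (ae_filter_ringOfSetsType mu).
  by move=> x H /H fx; exists 0 => //; rewrite -[X in is_derive _ _ _ X]oppr0; exact: is_deriveN.
move=> x y xab yab; wlog xy : x y xab yab / x <= y.
  by move=> h; have [/h->//|/ltW/h->] := leP x y.
apply/eqP; rewrite eq_le H1//=.
by have := H2 _ _ xab yab xy; rewrite /= lerN2.
Qed.

(* On a maximal interval where [f] is negative, [f] is nondecreasing and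
   starts from a nonnegative value. *)
Lemma ac_barrier a b f : absolutely_continuous a b f -> 0 <= f a ->
  {ae mu, forall x, x \in `]a, b[ -> f x < 0 ->
     exists2 d, 0 <= d & is_derive x 1 f d} ->
  {in `[a, b], forall x, 0 <= f x}.
Proof.
move=> acf fa f'0 x; rewrite in_itv/= => /andP[ax xb].
pose A := [set y | y \in `[a, x] /\ 0 <= f y].
have Aa : A a by split; rewrite // in_itv/= lexx.
have supA : has_sup A.
  split; first by exists a.
  by exists x => y []; rewrite in_itv/= => /andP[].
pose r := sup A.
have ar : a <= r by apply: ub_le_sup => //; exact: supA.2.
have rx : r <= x by apply: ge_sup; [exact: supA.1|move=> y []; rewrite in_itv/= => /andP[]].
have fr : 0 <= f r.
  rewrite leNgt; apply/negP => fr0.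
  have [|d d0 H] := ac_uniform acf (e := - f r); first by rewrite oppr_gt0.
  have [y [yax fy] ry] := sup_adherent d0 supA.
  have yr : y <= r by apply: ub_le_sup; [exact: supA.2|].
  have := H y r; rewrite !in_itv/= ar (le_trans rx xb) /=.
  move: yax; rewrite in_itv/= => /andP[ay yx]; rewrite ay (le_trans yx xb) => /(_ erefl erefl).
  have -> : `|y - r| < d by rewrite ltr_distl; move: ry yr; rewrite -/r; lra.
  by move=> /(_ erefl); rewrite ltr_distl; lra.
have := @ac_nondecreasing r x f (acW ar xb acf).
move=> H; apply: le_trans fr _; apply: H; rewrite ?in_itv/= ?lexx ?rx//.
apply: filterS f'0; first exact: (ae_filter_ringOfSetsType mu).
move=> y H; rewrite in_itv/= => /andP[ry yx]; apply: H.
  by rewrite in_itv/= (le_lt_trans ar ry) (lt_le_trans yx xb).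
rewrite ltNge; apply/negP => fy.
suff : y <= r by rewrite leNgt ry.
apply: ub_le_sup; first exact: supA.2.
by split => //; rewrite in_itv/= (ltW yx) (ltW (le_lt_trans ar ry)).
Qed.

End ac_lemmas.

(** * Lower bound on the cost of a path *)

Section cost_bound.
Context {R : realType}.
Notation mu := (@lebesgue_measure R).

(** Strictness is what identifies minimizers: equal costs force equal speeds almost everywhere. The
    values [0] of [p] and [q] are treated apart because the derivative of the power is used only at
    positive points. *)
Lemma powR_tangent_lt (alpha p q : R) : 1 < alpha -> 0 <= p -> 0 <= q -> p != q ->
  q `^ alpha + alpha * q `^ (alpha - 1) * (p - q) < p `^ alpha.
Proof.
move=> a1 p0; rewrite le_eqVlt => /predU1P[<-|q0] pq.
  rewrite !powR0 ?gt_eqF ?subr_gt0 ?(lt_trans ltr01)//.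
  by rewrite mulr0 mul0r addr0 powR_gt0// lt_neqAle eq_sym pq.
have qE : q `^ alpha = q * q `^ (alpha - 1).
  by rewrite mulr_powRB1 ?(ltW q0)// (lt_trans ltr01).
have qa0 : 0 < q `^ (alpha - 1) by rewrite powR_gt0.
move: p0; rewrite le_eqVlt => /predU1P[p0|p0].
  rewrite -p0 powR0 ?gt_eqF ?(lt_trans ltr01)// qE.
  have : 0 < (alpha - 1) * (q * q `^ (alpha - 1)) by rewrite !mulr_gt0// subr_gt0.
  by nra.
have der (x : R) : 0 < x -> is_derive x 1 (fun x : R => x `^ alpha) (alpha * x `^ (alpha - 1)).
  by move=> x0; exact: is_derive1_powR.
have cont (u v : R) : 0 < u -> {within `[u, v], continuous (fun x : R => x `^ alpha)}.
  move=> u0; apply: derivable_within_continuous => x; rewrite in_itv/= => /andP[ux _].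
  by apply: ex_derive; apply: der; exact: lt_le_trans ux.
have a10 : 0 < alpha - 1 by rewrite subr_gt0.
have a0 : 0 < alpha by lra.
have := pq; rewrite neq_lt => /orP[lt|lt].
- have [|c] := MVT lt _ (cont _ _ p0) (df := fun x => alpha * x `^ (alpha - 1)).
    by move=> x; rewrite in_itv/= => /andP[px _]; apply: der; exact: lt_trans px.
  rewrite in_itv/= => /andP[pc cq] /= E.
  have : c `^ (alpha - 1) < q `^ (alpha - 1).
    by rewrite gt0_ltr_powR ?nnegrE// ltW// (lt_trans p0).
  move: E; set A := c `^ _; set B := q `^ (alpha - 1); set Q := q `^ _; set P := p `^ _ => E AB.
  have -> : P = Q - alpha * A * (q - p) by rewrite -E; ring.
  have : 0 < alpha * (q - p) * (B - A) by rewrite !mulr_gt0// subr_gt0.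
  by nra.
- have [|c] := MVT lt _ (cont _ _ q0) (df := fun x => alpha * x `^ (alpha - 1)).
    by move=> x; rewrite in_itv/= => /andP[px _]; apply: der; exact: lt_trans px.
  rewrite in_itv/= => /andP[qc cp] /= E.
  have : q `^ (alpha - 1) < c `^ (alpha - 1).
    by rewrite gt0_ltr_powR ?nnegrE// ltW// (lt_trans q0).
  move: E; set A := c `^ _; set B := q `^ (alpha - 1); set Q := q `^ _; set P := p `^ _ => E AB.
  have -> : P = Q + alpha * A * (p - q) by rewrite -E; ring.
  have : 0 < alpha * (p - q) * (A - B) by rewrite !mulr_gt0// subr_gt0.
  by nra.
Qed.

Lemma powR_tangent_le (alpha p q : R) : 1 < alpha -> 0 <= p -> 0 <= q ->
  q `^ alpha + alpha * q `^ (alpha - 1) * (p - q) <= p `^ alpha.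
Proof.
move=> a1 p0 q0; have [->|pq] := eqVneq p q; first by rewrite subrr mulr0 addr0.
exact/ltW/powR_tangent_lt.
Qed.

(** Only [f] is measurable: [g] will be the weighted cost along [derive1 z]. The integral of a
    nonnegative function is a supremum over simple functions below it, and a simple function below
    [f] off the null set [N] and zero on it is below [g]. *)
Lemma ge0_ae_le_integral d (U : measurableType d)
    (m : {measure set U -> \bar R}) (D : set U) (f g : U -> \bar R) :
  measurable D -> measurable_fun D f ->
  (forall x, D x -> 0 <= f x)%E -> (forall x, D x -> 0 <= g x)%E ->
  {ae m, forall x, D x -> (f x <= g x)%E} ->
  (\int[m]_(x in D) f x <= \int[m]_(x in D) g x)%E.
Proof.
move=> mD mf f0 g0 [N [mN N0 sub]].
have -> : (\int[m]_(x in D) f x = \int[m]_(x in D `\` N) f x)%E.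
  exact: ge0_negligible_integral.
have f0' x : (D `\` N) x -> (0 <= f x)%E by move=> [Dx _]; exact: f0.
rewrite (ge0_integralE _ f0') (ge0_integralE _ g0); apply: ereal_sup_le.
move=> _ [h hf <-]; exists h => // x; apply: le_trans (hf x) _.
rewrite !patchE; case: ifPn => [|_]; last first.
  by case: ifPn => // /set_mem /g0.
move=> /set_mem[Dx Nx]; rewrite (mem_set Dx).
by apply: contrapT => fg; apply: Nx; apply: sub => /(_ Dx).
Qed.

Lemma ae_imp (P Q : R -> Prop) : {ae mu, forall x, P x} ->
  (forall x, P x -> Q x) -> {ae mu, forall x, Q x}.
Proof.
move=> Pae PQ; apply: filterS Pae; last exact: PQ.
exact: (ae_filter_ringOfSetsType mu).
Qed.

Lemma ae_neq (c : R) : {ae mu, forall x, x <> c}.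
Proof.
have : mu.-negligible [set c].
  by exists [set c]; split => //; exact: lebesgue_measure_set1.
by apply: negligibleS => x /= /contrapT.
Qed.

Lemma ae_itv_oo_cc (a b : R) (P : R -> Prop) :
  {ae mu, forall x, x \in `]a, b[ -> P x} ->
  {ae mu, forall x, x \in `[a, b] -> P x}.
Proof.
have Fae := ae_filter_ringOfSetsType mu.
apply: filterS3 (ae_neq a) (ae_neq b) => x xa xb Px.
rewrite in_itv/= !le_eqVlt => /andP[/predU1P[/esym//|ax] /predU1P[//|xb']].
by apply: Px; rewrite in_itv/= ax.
Qed.

Lemma cost_ge0 (alpha d : R) : (0 <= cost alpha d)%E.
Proof. by rewrite /cost; case: ifP => // _; rewrite lee_fin powR_ge0. Qed.

Lemma measurable_cost (alpha : R) : measurable_fun setT (cost alpha).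
Proof.
apply: measurable_fun_ifT => //.
- exact: measurable_fun_ler.
- by apply/measurable_EFinP; exact: measurable_powR.
Qed.

(** * Paths satisfying the Euler-Lagrange equation *)

Section optimal_path.
Variables (alpha t T c : R) (gamma q : R -> R).
Hypotheses (alpha_gt1 : 1 < alpha) (tT : t < T).
Hypothesis gamma_gt0 : forall s, s \in `[t, T] -> 0 < gamma s.
Hypothesis gamma_meas : measurable_fun `[t, T] gamma.
Hypothesis q_ge0 : forall s, s \in `[t, T] -> 0 <= q s.
Hypothesis q_int : mu.-integrable `[t, T] (EFin \o q).
Hypothesis gamma_q : forall s, s \in `[t, T] -> gamma s * q s `^ (alpha - 1) = c.

Let J := \int[mu]_(s in `[t, T]) q s.

(* Euler-Lagrange: [alpha * c] is the constant multiplier of [q]. *)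
Lemma weighted_cost_lt s p : s \in `[t, T] -> p != q s ->
  ((c * q s + alpha * c * (p - q s))%:E < (gamma s)%:E * cost alpha p)%E.
Proof.
move=> sI pq; have g0 := gamma_gt0 sI; have q0 := q_ge0 sI; rewrite /cost.
case: ifPn => p0; last by rewrite gt0_muley ?ltry// lte_fin.
rewrite -EFinM lte_fin.
have : gamma s * (q s `^ alpha + alpha * q s `^ (alpha - 1) * (p - q s)) <
    gamma s * p `^ alpha by rewrite ltr_pM2l//; exact: powR_tangent_lt.
move=> H; apply: le_lt_trans H.
have -> : q s `^ alpha = q s * q s `^ (alpha - 1).
  by rewrite mulr_powRB1// (lt_trans ltr01).
rewrite -(gamma_q sI).
by rewrite le_eqVlt; apply/orP; left; apply/eqP; ring.
Qed.

Lemma weighted_cost_le s p : s \in `[t, T] ->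
  ((c * q s + alpha * c * (p - q s))%:E <= (gamma s)%:E * cost alpha p)%E.
Proof.
move=> sI; have [->|pq] := eqVneq p (q s); last exact/ltW/weighted_cost_lt.
have g0 := gamma_gt0 sI; have q0 := q_ge0 sI.
rewrite /cost q0 -EFinM lee_fin subrr mulr0 addr0 -(gamma_q sI).
have -> : q s `^ alpha = q s * q s `^ (alpha - 1).
  by rewrite mulr_powRB1// (lt_trans ltr01).
by rewrite mulrAC mulrA.
Qed.

Section competitor.
Variable z : R -> R.
Hypothesis acz : absolutely_continuous t T z.
(** One condition for both kinds of plan: it is vacuous when [c = 0], the case of staying put, and
    for [c > 0] it says that [z] gets at least as far as the path of speed [q]. *)
Hypothesis cz : 0 <= c * (z T - z t - J).

Let I := (\int[mu]_(s in `[t, T]) ((gamma s)%:E * cost alpha (derive1 z s)))%E.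

(** Integrating the tangent inequality bounds the cost below by the integral of [lin], whose linear
    part has the sign given by [cz]. If the bound is attained, the nonnegative gap [h] has zero
    integral, and strictness of the tangent inequality forces [p = q] almost everywhere. *)
Lemma cost_bound : ((c * J)%:E <= I)%E /\
  ((I <= (c * J)%:E)%E -> forall s, s \in `[t, T] ->
     z s - z t = \int[mu]_(r in `[t, s]) q r).
Proof.
have [p [intp Hp Hd]] := ac_density tT acz.
have mD : measurable (`[t, T]%classic : set R) by exact: measurable_itv.
have intpD : mu.-integrable `[t, T] (EFin \o p) by apply: integrableS intp.
have mp : measurable_fun (`[t, T]%classic : set R) p.
  by apply/measurable_EFinP; case/integrableP: intpD.
have mq : measurable_fun (`[t, T]%classic : set R) q.
  by apply/measurable_EFinP; case/integrableP: q_int.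
pose f1 s := ((gamma s)%:E * cost alpha (p s))%E.
have mf1 : measurable_fun (`[t, T]%classic : set R) f1.
  apply: emeasurable_funM; first exact/measurable_EFinP.
  by apply: measurableT_comp mp; exact: measurable_cost.
have f10 s : `[t, T]%classic s -> (0 <= f1 s)%E.
  by move=> sI; rewrite mule_ge0 ?cost_ge0// lee_fin ltW// gamma_gt0.
(* The measurable density replaces [derive1 z] at the price of an inequality, whose direction serves
   both the lower bound and the equality case. *)
have If1 : (\int[mu]_(s in `[t, T]) f1 s <= I)%E.
  apply: ge0_ae_le_integral => //.
    by move=> s sI; rewrite mule_ge0 ?cost_ge0// lee_fin ltW// gamma_gt0.
  apply: ae_itv_oo_cc; apply: filterS Hd; first exact: (ae_filter_ringOfSetsType mu).
  by move=> s Hs sI; rewrite derive1E; have [|_ ->] := Hs.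
pose lin s := c * q s + alpha * c * (p s - q s).
have intcq : mu.-integrable `[t, T] (EFin \o (fun s => c * q s)).
  by rewrite (_ : _ \o _ = (fun s => c%:E * (q s)%:E)%E); [exact: integrableZl|exact/funext].
have intpq : mu.-integrable `[t, T] (EFin \o (fun s => p s - q s)).
  by rewrite (_ : _ \o _ = (fun s => (p s)%:E - (q s)%:E)%E); [exact: integrableB|exact/funext].
have intapq : mu.-integrable `[t, T] (EFin \o (fun s => alpha * c * (p s - q s))).
  rewrite (_ : _ \o _ = (fun s => (alpha * c)%:E * (p s - q s)%:E)%E); last exact/funext.
  exact: integrableZl.
have intlin : mu.-integrable `[t, T] (EFin \o lin).
  rewrite (_ : _ \o _ = (fun s => (c * q s)%:E + (alpha * c * (p s - q s))%:E)%E);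
    last exact/funext.
  exact: integrableD.
have Ilin : (\int[mu]_(s in `[t, T]) (lin s)%:E =
    (c * J + alpha * (c * (z T - z t - J)))%:E)%E.
  rewrite -[LHS]fineK; last exact: integrable_fin_num.
  congr EFin; rewrite -/(Rintegral _ _ _) /lin.
  rewrite RintegralD// !RintegralZl//.
  rewrite RintegralB// -/J -Hp ?in_itv/= ?lexx ?(ltW tT)//.
  by rewrite mulrA.
have abs_f1 : (\int[mu]_(s in `[t, T]) `|f1 s| = \int[mu]_(s in `[t, T]) f1 s)%E.
  by apply: eq_integral => s /set_mem sI; rewrite gee0_abs// f10.
have lin_le : (\int[mu]_(s in `[t, T]) (lin s)%:E <= \int[mu]_(s in `[t, T]) f1 s)%E.
  have [f1fin|] := ltP (\int[mu]_(s in `[t, T]) f1 s)%E +oo%E; last first.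
    by rewrite leye_eq => /eqP ->; rewrite leey.
  apply: le_integral => //.
    by apply/integrableP; split => //; rewrite abs_f1.
  by move=> s /set_mem sI; exact: weighted_cost_le.
have J_le : ((c * J)%:E <= \int[mu]_(s in `[t, T]) (lin s)%:E)%E.
  by rewrite Ilin lee_fin lerDl mulr_ge0// ltW// (lt_trans ltr01).
split; first exact: le_trans J_le (le_trans lin_le If1).
move=> IJ s; rewrite in_itv/= => /andP[ts sT].
rewrite Hp ?in_itv/= ?ts//.
have intf1 : mu.-integrable `[t, T] f1.
  apply/integrableP; split => //; rewrite abs_f1.
  by apply: le_lt_trans If1 (le_lt_trans IJ (ltry _)).
pose h s := (f1 s - (lin s)%:E)%E.
have h0 r : `[t, T]%classic r -> (0 <= h r)%E.
  by move=> rI; rewrite sube_ge0//; exact: weighted_cost_le.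
have mh : measurable_fun (`[t, T]%classic : set R) h.
  by apply: emeasurable_funB => //; case/integrableP: intlin.
have : (\int[mu]_(s in `[t, T]) `|h s| = 0)%E.
  have -> : (\int[mu]_(s in `[t, T]) `|h s| = \int[mu]_(s in `[t, T]) h s)%E.
    by apply: eq_integral => r /set_mem rI; rewrite gee0_abs// h0.
  apply/eqP; rewrite eq_le; apply/andP; split; last exact: integral_ge0.
  rewrite integralB// sube_le0.
  exact: le_trans If1 (le_trans IJ J_le).
move/(ae_eq_integral_abs mu mD mh).1 => hae0.
have hae : {ae mu, forall r, `[t, T]%classic r -> h r = 0%E} := hae0.
have aepq : {ae mu, forall r, `[t, T]%classic r -> p r = q r}.
  have := hae; apply: filterS; first exact: (ae_filter_ringOfSetsType mu).
  move=> r H rI; apply/eqP/negPn/negP => pq.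
  have := weighted_cost_lt rI pq; rewrite -sube_gt0.
  by rewrite -/(lin r) -/(f1 r) -/(h r) H// ltxx.
have sub : `[t, s]%classic `<=` `[t, T]%classic.
  by move=> r /=; rewrite !in_itv/= => /andP[-> rs]/=; exact: le_trans sT.
rewrite /Rintegral; congr fine; apply: ae_eq_integral => //.
- by apply/measurable_EFinP; exact: measurable_funS sub mp.
- by apply/measurable_EFinP; exact: measurable_funS sub mq.
have := aepq; apply: filterS; first exact: (ae_filter_ringOfSetsType mu).
by move=> r H rI /=; rewrite H//; exact: sub.
Qed.

End competitor.
End optimal_path.
End cost_bound.

(** * Plans under hyperbolic discounting *)

Lemma Rintegral_derive {R : realType} (f F : R -> R) (a b : R) : a <= b ->
  (forall x, x \in `[a, b] -> is_derive x 1 F (f x)) ->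
  (forall x, x \in `[a, b] -> {for x, continuous f}) ->
  \int[@lebesgue_measure R]_(x in `[a, b]) f x = F b - F a.
Proof.
move=> ab dF cf; move: ab; rewrite le_eqVlt => /predU1P[<-|ab].
  by rewrite set_itv1 Rintegral_set1 subrr.
rewrite /Rintegral (@continuous_FTC2 R f F) //.
- by apply/subspace_continuousP => x xab; apply: cvg_within_filter; exact: cf.
- have cF x : x \in `[a, b] -> {for x, continuous F}.
    move=> /dF dFx; apply: differentiable_continuous; apply/derivable1_diffP.
    exact: ex_derive.
  split.
  + by move=> x xab; apply: ex_derive; apply: dF; exact: subset_itv_oo_cc.
  + by apply: cvg_at_right_filter; apply: cF; rewrite in_itv/= lexx ltW.
  + by apply: cvg_at_left_filter; apply: cF; rewrite in_itv/= lexx ltW.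
- move=> x xab; rewrite derive1E.
  by have [|_ ->] := dF x; first exact: subset_itv_oo_cc.
Qed.

Lemma is_derive1_powR_comp {R : realType} (a : R) (g : R -> R) (x dg : R) :
  0 < g x -> is_derive x 1 g dg ->
  is_derive x 1 (fun x => g x `^ a) (a * g x `^ (a - 1) * dg).
Proof.
move=> gx d; exact: (@is_derive1_comp _ (@powR R ^~ a) g _ _ _
  (is_derive1_powR a gx) d).
Qed.

Section plan.
Context {R : realType}.
Variables (T alpha lambda mu : R).
Hypothesis alpha_gt1 : 1 < alpha.
Hypotheses (lambda_gt0 : 0 < lambda) (mu_gt0 : 0 < mu).
Notation leb := (@lebesgue_measure R).

(** The discounted marginal cost is constant when the power [alpha - 1] of the speed is proportional
    to the inverse discount, that is, to the power [mu / lambda] of [1 + lambda * (s - t)]; this is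
    the resulting exponent of the speed. *)
Definition growth_exponent : R := mu / (lambda * (alpha - 1)).
Notation beta := growth_exponent.

(* [\int_0^w (1 + lambda r)^beta dr]; the speed of an optimal path is
   proportional to [(1 + lambda r)^beta] at time lag [r]. *)
Definition profile (w : R) : R :=
  ((1 + lambda * w) `^ (beta + 1) - 1) / (lambda * (beta + 1)).

Notation gamma := (hyperbolic_discount lambda mu).

Let a10 : 0 < alpha - 1. Proof. by rewrite subr_gt0. Qed.

Lemma growth_exponent_gt0 : 0 < beta.
Proof. by rewrite divr_gt0// mulr_gt0. Qed.
Let beta_gt0 := growth_exponent_gt0.

Lemma growth_exponentE : mu / lambda = beta * (alpha - 1).
Proof.
by rewrite /beta invfM mulrA -[RHS]mulrA mulVf ?mulr1// gt_eqF.
Qed.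

Let lag_gt0 w : 0 <= w -> 0 < 1 + lambda * w.
Proof. by move=> w0; rewrite ltr_wpDr// mulr_ge0// ltW. Qed.

Lemma powR_split C w : 0 <= C -> C `^ (alpha - 1) * (C * w) = C `^ alpha * w.
Proof.
move=> C0; rewrite mulrA; congr (_ * _); apply/esym; rewrite mulrC mulr_powRB1//.
exact: lt_trans alpha_gt1.
Qed.

Lemma is_derive_profile (t s : R) : 0 < 1 + lambda * (s - t) ->
  is_derive s 1 (fun s => profile (s - t)) ((1 + lambda * (s - t)) `^ beta).
Proof.
move=> u0.
have d1 : is_derive s 1 (fun s => 1 + lambda * (s - t)) lambda.
  by apply: is_derive_eq; rewrite /GRing.scale/=; ring.
have := @is_derive1_powR_comp R (beta + 1) (fun s => 1 + lambda * (s - t)) s lambda u0 d1.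
rewrite addrK => d2.
rewrite /profile; apply: is_derive_eq.
rewrite /GRing.scale/= /cst.
have l0 : lambda != 0 by rewrite gt_eqF.
have b0 : beta + 1 != 0 by rewrite gt_eqF// addr_gt0.
by field; rewrite b0.
Qed.

Lemma profile0 : profile 0 = 0.
Proof. by rewrite /profile mulr0 addr0 powR1 subrr mul0r. Qed.

Lemma profile_lt w w' : 0 <= w -> w < w' -> profile w < profile w'.
Proof.
move=> w0 ww'; rewrite /profile ltr_pM2r; last first.
  by rewrite invr_gt0 mulr_gt0// addr_gt0.
rewrite ltrD2r gt0_ltr_powR ?addr_gt0 ?nnegrE ?(ltW (lag_gt0 _))//.
  by rewrite (le_trans w0)// ltW.
by rewrite ltrD2l ltr_pM2l.
Qed.

Lemma profile_gt0 w : 0 < w -> 0 < profile w.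
Proof. by move=> w0; rewrite -profile0 profile_lt. Qed.

Section from_time.
Variable t : R.
Hypothesis tT : t < T.

(** An extremal: affine in the clock [profile (s - t)] rather than in [s]. As [profile] has slope
    [1] at [0], the constant [C] is the initial speed. *)
Definition straight_path (x C : R) : R -> R := fun s => x + C * profile (s - t).

Let u0 s : s \in `[t, T] -> 0 < 1 + lambda * (s - t).
Proof. by rewrite in_itv/= => /andP[ts _]; apply: lag_gt0; rewrite subr_ge0. Qed.

Lemma is_derive_straight_path x C s : s \in `[t, T] ->
  is_derive s 1 (straight_path x C) (C * (1 + lambda * (s - t)) `^ beta).
Proof.
move=> /u0 us; have d := is_derive_profile us.
rewrite /straight_path; apply: is_derive_eq.
by rewrite /GRing.scale/= add0r mul1r.
Qed.

Let speed (C s : R) := C * (1 + lambda * (s - t)) `^ beta.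

Lemma continuous_speed C s : s \in `[t, T] -> {for s, continuous (speed C)}.
Proof.
move=> /u0 us; rewrite /speed; apply: differentiable_continuous.
apply/derivable1_diffP; apply: ex_derive.
have d1 : is_derive s 1 (fun s => 1 + lambda * (s - t)) lambda.
  by apply: is_derive_eq; rewrite /GRing.scale/=; ring.
have d2 := @is_derive1_powR_comp R beta (fun s => 1 + lambda * (s - t)) s lambda us d1.
exact: is_deriveZ.
Qed.

Lemma Rintegral_speed C s : s \in `[t, T] ->
  \int[leb]_(r in `[t, s]) speed C r = C * profile (s - t).
Proof.
rewrite in_itv/= => /andP[ts sT].
have sub r : r \in `[t, s] -> r \in `[t, T].
  by rewrite !in_itv/= => /andP[-> /le_trans]; apply.
have dP r : r \in `[t, s] -> is_derive r 1 (straight_path 0 C) (speed C r).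
  by move=> /sub; exact: is_derive_straight_path.
have -> := @Rintegral_derive _ (speed C) (straight_path 0 C) t s ts dP.
- by rewrite /straight_path subrr profile0 mulr0 !add0r subr0.
- by move=> r /sub; exact: continuous_speed.
Qed.

Lemma ac_straight_path x C : absolutely_continuous t T (straight_path x C).
Proof.
pose L := `|C| * (1 + lambda * (T - t)) `^ beta.
apply: (@lipschitz_ac _ _ _ _ L); first by rewrite mulr_ge0// powR_ge0.
move=> u v tu uv vT.
have sub r : r \in `[u, v] -> r \in `[t, T].
  by rewrite !in_itv/= => /andP[/(le_trans tu)-> rv]; exact: le_trans vT.
have [|r|r ruv ->] := @MVT_segment _ (straight_path x C)
    (fun s => C * (1 + lambda * (s - t)) `^ beta) u v uv.
- move=> r ruv; apply: is_derive_straight_path; apply: sub.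
  exact: subset_itv_oo_cc.
- apply: derivable_within_continuous => s /sub sI.
  by have [] := is_derive_straight_path x C sI.
rewrite !normrM [`|v - u|]ger0_norm ?subr_ge0// ler_wpM2r ?subr_ge0//.
rewrite ler_wpM2l// ger0_norm ?powR_ge0//.
have /[dup] rI := sub _ ruv; rewrite in_itv/= => /andP[tr rT].
have rT' : 1 + lambda * (r - t) <= 1 + lambda * (T - t).
  by rewrite lerD2l ler_pM2l// lerD2r.
by apply: ge0_ler_powR => //; rewrite ?nnegrE ?(ltW beta_gt0)// ltW ?u0// in_itv/= lexx ltW.
Qed.

Lemma discount_speed C s : 0 <= C -> s \in `[t, T] ->
  gamma t s * speed C s `^ (alpha - 1) = C `^ (alpha - 1).
Proof.
move=> C0 sI; have us := u0 sI.
rewrite /hyperbolic_discount /speed powRM ?powR_ge0// -powRrM mulrCA.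
rewrite -powRD ?(gt_eqF us) ?implybT// growth_exponentE addNr powRr0 mulr1.
by [].
Qed.

Lemma discount_gt0 s : s \in `[t, T] -> 0 < gamma t s.
Proof. by move=> /u0 us; rewrite powR_gt0. Qed.

Let measurable_discount : measurable_fun (`[t, T]%classic : set R) (gamma t).
Proof.
apply: measurable_funTS; rewrite /hyperbolic_discount.
by apply: (measurableT_comp (measurable_powR _)); apply: measurable_funD => //;
  apply: measurable_funM => //; apply: measurable_funB.
Qed.

Let integrable_speed C : leb.-integrable `[t, T] (EFin \o speed C).
Proof.
apply: continuous_compact_integrable; first exact: segment_compact.
apply/subspace_continuousP => s sI; apply: cvg_within_filter.
exact: continuous_speed.
Qed.

Definition running_cost (y : R -> R) : \bar R :=
  (\int[leb]_(s in `[t, T]) ((gamma t s)%:E * cost alpha (derive1 y s)))%E.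

Lemma running_cost_straight_path x C : 0 <= C ->
  running_cost (straight_path x C) = (C `^ alpha * profile (T - t))%:E.
Proof.
move=> C0; have tI : T \in `[t, T] by rewrite in_itv/= lexx ltW.
transitivity (\int[leb]_(s in `[t, T]) (C `^ (alpha - 1) * speed C s)%:E)%E.
  apply: eq_integral => s /set_mem sI.
  rewrite derive1E; have [_ ->] := is_derive_straight_path x C sI.
  rewrite /cost mulr_ge0 ?powR_ge0// -EFinM; congr EFin.
  rewrite -(discount_speed C0 sI) -mulrA; congr (_ * _); apply/esym; rewrite mulrC mulr_powRB1//.
    by rewrite mulr_ge0 ?powR_ge0.
  exact: lt_trans alpha_gt1.
rewrite -[LHS]fineK; last first.
  apply: integrable_fin_num => //.
  rewrite (_ : (fun _ => _) = (fun s => (C `^ (alpha - 1))%:E * (speed C s)%:E)%E).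
    by apply: integrableZl => //; exact: integrable_speed.
  exact/funext.
rewrite -/(Rintegral _ _ _) RintegralZl// Rintegral_speed//.
by rewrite powR_split.
Qed.

Lemma running_cost_ge x C z : 0 <= C -> admissible T t x z ->
  0 <= C `^ (alpha - 1) * (z T - x - C * profile (T - t)) ->
  ((C `^ alpha * profile (T - t))%:E <= running_cost z)%E /\
  ((running_cost z <= (C `^ alpha * profile (T - t))%:E)%E ->
   {in `[t, T], z =1 straight_path x C}).
Proof.
move=> C0 [acz zt] Hz; have tI : T \in `[t, T] by rewrite in_itv/= lexx ltW.
have JE := Rintegral_speed C tI.
have E : C `^ alpha * profile (T - t) = C `^ (alpha - 1) * (\int[leb]_(s in `[t, T]) speed C s).
  by rewrite JE powR_split.
have speed_ge0 s : s \in `[t, T] -> 0 <= speed C s by rewrite mulr_ge0 ?powR_ge0.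
have [|lb eq] := cost_bound alpha_gt1 tT discount_gt0 measurable_discount
  speed_ge0 (integrable_speed C) (fun s => @discount_speed C s C0) acz.
  by rewrite JE zt.
rewrite E; split => // /eq H s sI.
by rewrite /straight_path -Rintegral_speed// -H// zt addrC subrK.
Qed.

Lemma initial_derivative_straight_path x C z : {in `[t, T], z =1 straight_path x C} ->
  has_initial_derivative z t C.
Proof.
move=> zE; have tI : t \in `[t, T] by rewrite in_itv/= lexx ltW.
have [d dE] := is_derive_straight_path x C tI.
move: dE; rewrite subrr mulr0 addr0 powR1 mulr1 => dE.
have : h^-1 *: (straight_path x C (h + t) - straight_path x C t) @[h --> 0^'+] --> C.
  rewrite -[X in _ --> X]dE /derive; apply: cvg_dnbhs_at_right => //.
  have -> : (fun h : R => h^-1 *: (straight_path x C (h + t) - straight_path x C t)) =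
      (fun h => h^-1 *: ((straight_path x C \o shift t) (h *: 1) - straight_path x C t)).
    by apply/funext => h /=; rewrite /GRing.scale/= mulr1.
  exact: d.
apply: cvg_trans; apply: near_eq_cvg; near=> h.
rewrite (zE t tI) zE; first by rewrite [t + h]addrC /GRing.scale/= mulrC.
have h0 : 0 < h by near: h; exact: nbhs_right_gt.
have hT : h < T - t by near: h; apply: nbhs_right_lt; rewrite subr_gt0.
by rewrite in_itv/=; apply/andP; split; lra.
Unshelve. all: by end_near. Qed.

End from_time.
End plan.

(** * The choice between moving and stopping *)

Section planned.
Context {R : realType}.
Variables (T rew alpha lambda mu : R).
Hypotheses (rew_gt0 : 0 < rew) (alpha_gt1 : 1 < alpha).
Hypotheses (lambda_gt0 : 0 < lambda) (mu_gt0 : 0 < mu).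
Notation gamma := (hyperbolic_discount lambda mu).
Notation profile := (profile alpha lambda mu).
Notation path := (straight_path alpha lambda mu).

(* The remaining distance [d] is worth covering from time [t] on iff
   [d `^ alpha <= rew * threshold t]. *)
Definition threshold (t : R) : R :=
  profile (T - t) `^ (alpha - 1) * gamma t T.

(** The non-strict inequality is the tie-breaking rule: at equality both plans are minimal and the
    moving one starts faster. From [theta] on the reward is secured and staying is free. *)
Definition plan_rate (theta t x : R) : R :=
  if (x < theta) && ((theta - x) `^ alpha <= rew * threshold t)
  then (theta - x) / profile (T - t) else 0.

Lemma plan_rate_ge0 theta t x : t < T -> 0 <= plan_rate theta t x.
Proof.
move=> tT; rewrite /plan_rate; case: ifP => // /andP[xth _].
have P0 : 0 < profile (T - t) by rewrite profile_gt0// subr_gt0.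
by apply: divr_ge0; rewrite ?subr_ge0 ltW.
Qed.

Lemma perceived_costE theta t y : perceived_cost T rew alpha gamma theta t y =
  (running_cost T alpha lambda mu t y -
    (if theta <= y T then gamma t T * rew else 0)%:E)%E.
Proof. by []. Qed.

Lemma initial_derivative_unique (y : R -> R) t v w :
  has_initial_derivative y t v -> has_initial_derivative y t w -> v = w.
Proof. exact: cvg_unique. Qed.

(** A competitor that ends at or beyond [theta] is compared with the extremal ending exactly there,
    any other with the constant path. The equality cases of these bounds determine the initial
    derivative of every minimizer, which settles the tie-breaking clause. *)
Lemma planned_path_exists theta t x : t < T ->
  exists y, planned_path T rew alpha gamma theta t x y (plan_rate theta t x).
Proof.
move=> tT; have tI : t \in `[t, T] by rewrite in_itv/= lexx ltW.
have TI : T \in `[t, T] by rewrite in_itv/= lexx ltW.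
have P0 : 0 < profile (T - t) by rewrite profile_gt0// subr_gt0.
set v := plan_rate theta t x; have v0 : 0 <= v by exact: plan_rate_ge0.
have gT : 0 < gamma t T * rew by rewrite mulr_gt0// (discount_gt0 (T := T)).
have a0 : alpha != 0 by rewrite gt_eqF// (lt_trans ltr01).
have am1 : alpha - 1 != 0 by rewrite gt_eqF// subr_gt0.
exists (path t x v).
have adm : admissible T t x (path t x v).
  split; first exact: ac_straight_path.
  by rewrite /straight_path subrr profile0 mulr0 addr0.
have self C : has_initial_derivative (path t x C) t C.
  exact: (@initial_derivative_straight_path _ T _ _ _ alpha_gt1 lambda_gt0 mu_gt0
    t tT x C _ (fun _ _ => erefl)).
have pathT C : path t x C T = x + C * profile (T - t) by [].
have still z : admissible T t x z ->
    ((0%:E <= running_cost T alpha lambda mu t z)%E /\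
     ((running_cost T alpha lambda mu t z <= 0%:E)%E ->
      has_initial_derivative z t 0)).
  move=> az; have [|lb eq] := @running_cost_ge R T alpha lambda mu alpha_gt1
    lambda_gt0 mu_gt0 t tT x 0 z (lexx 0) az.
    by rewrite powR0// mul0r.
  rewrite powR0// mul0r in lb eq; split => // /eq.
  exact: initial_derivative_straight_path.
pose C1 := (theta - x) / profile (T - t).
(* Origin of [threshold]: this cost of covering the whole distance is weighed against the discounted
   reward [gamma t T * rew]. *)
have C1E : x < theta -> C1 `^ alpha * profile (T - t) =
    (theta - x) `^ alpha / profile (T - t) `^ (alpha - 1).
  move=> xth; rewrite /C1 powRM ?subr_ge0 ?(ltW xth) ?invr_ge0 ?(ltW P0)// -mulrA.
  congr (_ * _); rewrite -powR_inv1 ?(ltW P0)// -powRrM -powRN.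
  rewrite -[X in _ * X]powRr1 ?(ltW P0)// -powRD ?(gt_eqF P0) ?implybT//.
  by congr (_ `^ _); ring.
have moving z : x < theta -> theta <= z T -> admissible T t x z ->
    ((((theta - x) `^ alpha / profile (T - t) `^ (alpha - 1))%:E
       <= running_cost T alpha lambda mu t z)%E /\
     ((running_cost T alpha lambda mu t z <=
         ((theta - x) `^ alpha / profile (T - t) `^ (alpha - 1))%:E)%E ->
      has_initial_derivative z t C1)).
  move=> xth zth az; have C10 : 0 <= C1 by apply: divr_ge0; rewrite ?subr_ge0 ltW.
  have := @running_cost_ge R T alpha lambda mu alpha_gt1
    lambda_gt0 mu_gt0 t tT x C1 z C10 az.
  rewrite (C1E xth); case=> [|lb eq]; last first.
    split => // /eq; exact: initial_derivative_straight_path.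
  rewrite mulr_ge0 ?powR_ge0// /C1 divfK ?gt_eqF//.
  by rewrite opprB addrA subrK subr_ge0.
have [th|xth] := leP theta x.
  have vE : v = 0 by rewrite /v /plan_rate ltNge th.
  have PC : perceived_cost T rew alpha gamma theta t (path t x v) =
      (- (gamma t T * rew))%:E.
    rewrite perceived_costE running_cost_straight_path// vE powR0// mul0r.
    by rewrite pathT mul0r addr0 th sub0e.
  have PCz z : (running_cost T alpha lambda mu t z - (gamma t T * rew)%:E <=
      perceived_cost T rew alpha gamma theta t z)%E.
    rewrite perceived_costE leeB// lee_fin; case: ifP => // _; exact: ltW.
  split.
  - split=> // z /still[lb _]; rewrite PC; apply: le_trans (PCz z).
    by rewrite EFinN -[leLHS]add0e leeB.
  - exact: self.
  - move=> z w [az /(_ _ adm)]; rewrite PC => zmin zw.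
    have [_ H] := still _ az.
    rewrite (initial_derivative_unique zw (H _)) ?vE//.
    by have := le_trans (PCz z) zmin; rewrite leeBlDr// -EFinD addNr.
have nth : (theta <= x) = false by rewrite leNgt xth.
have thT : threshold t * rew = profile (T - t) `^ (alpha - 1) * (gamma t T * rew).
  by rewrite /threshold mulrA.
have Pa : 0 < profile (T - t) `^ (alpha - 1) by rewrite powR_gt0.
have mE : ((theta - x) `^ alpha / profile (T - t) `^ (alpha - 1) <= gamma t T * rew) =
    ((theta - x) `^ alpha <= rew * threshold t).
  by rewrite ler_pdivrMr// [rew * _]mulrC thT [_ * (_ * rew)]mulrC.
have [go|stop] := leP ((theta - x) `^ alpha) (rew * threshold t).
  have vE : v = C1 by rewrite /v /plan_rate xth go.
  rewrite go in mE; set m := (theta - x) `^ alpha / _ in moving mE.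
  have thz : theta <= path t x v T.
    by rewrite pathT vE /C1 divfK ?gt_eqF// addrCA subrr addr0.
  have PC : perceived_cost T rew alpha gamma theta t (path t x v) =
      (m - gamma t T * rew)%:E.
    by rewrite perceived_costE thz EFinB running_cost_straight_path// vE C1E.
  split.
  - split=> // z az'; rewrite PC perceived_costE; case: ifPn => [thz'|_].
      by rewrite EFinB leeB// (moving z xth thz' az').1.
    by rewrite sube0; apply: le_trans (still z az').1; rewrite lee_fin subr_le0.
  - exact: self.
  - move=> z w [az' /(_ _ adm)]; rewrite PC perceived_costE => zmin zw.
    move: zmin; case: ifPn => [thz'|_] zmin.
      rewrite vE (initial_derivative_unique zw ((moving z xth thz' az').2 _))//.
      by rewrite leeBlDr// -EFinD subrK in zmin.
    rewrite (initial_derivative_unique zw ((still z az').2 _))//.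
    by rewrite sube0 in zmin; apply: le_trans zmin _; rewrite lee_fin subr_le0.
have vE : v = 0 by rewrite /v /plan_rate xth leNgt stop.
move: mE; rewrite [in RHS]leNgt stop => /negbT; rewrite -ltNge => mE.
have PC : perceived_cost T rew alpha gamma theta t (path t x v) = 0%:E.
  rewrite perceived_costE running_cost_straight_path// vE powR0// mul0r.
  by rewrite pathT mul0r addr0 nth sube0.
split.
- split=> // z az'; rewrite PC perceived_costE; case: ifPn => [thz'|_].
    rewrite sube_ge0//; apply: le_trans (moving z xth thz' az').1.
    by rewrite lee_fin ltW.
  by rewrite sube0; exact: (still z az').1.
- exact: self.
- move=> z w [az' /(_ _ adm)]; rewrite PC perceived_costE => zmin zw.
  move: zmin; case: ifPn => [thz'|_] zmin.
    exfalso; move: zmin; rewrite leeBlDr// add0e => /(le_trans (moving z xth thz' az').1).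
    by rewrite lee_fin leNgt mE.
  rewrite vE (initial_derivative_unique zw ((still z az').2 _))//.
  by rewrite sube0 in zmin.
Qed.

Lemma planned_path_rate theta t x y v : t < T ->
  planned_path T rew alpha gamma theta t x y v -> v = plan_rate theta t x.
Proof.
move=> tT [ymin yv ymax]; have [z [zmin zv zmax]] := planned_path_exists theta x tT.
by apply/eqP; rewrite eq_le (zmax _ _ ymin yv) (ymax _ _ zmin zv).
Qed.

End planned.

(** * Trajectories *)

Section decay.
Context {R : realType}.
Variables (T alpha lambda mu : R).
Hypotheses (T_gt0 : 0 < T) (alpha_gt1 : 1 < alpha).
Hypotheses (lambda_gt0 : 0 < lambda) (mu_gt0 : 0 < mu).
Notation gamma := (hyperbolic_discount lambda mu).
Notation profile := (profile alpha lambda mu).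
Notation beta := (growth_exponent alpha lambda mu).
Notation eta := (Defs.eta T alpha lambda mu).
Notation leb := (@lebesgue_measure R).

Let kappa := lambda * (beta + 1).

Let a10 : 0 < alpha - 1. Proof. by rewrite subr_gt0. Qed.
Let beta0 : 0 < beta. Proof. exact: growth_exponent_gt0. Qed.
Let kappa0 : 0 < kappa. Proof. by rewrite mulr_gt0// addr_gt0. Qed.
Let prof0 s : s < T -> 0 < profile (T - s).
Proof. by move=> sT; rewrite profile_gt0// subr_gt0. Qed.
Let lag0 s : s < T -> 0 < 1 + lambda * (T - s).
Proof. by move=> sT; rewrite addr_gt0// mulr_gt0// subr_gt0. Qed.

Let kappa_profile w : kappa * profile w = (1 + lambda * w) `^ (beta + 1) - 1.
Proof. by rewrite /profile mulrCA divff ?mulr1// gt_eqF. Qed.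

Let rate (s : R) := ((1 + lambda * (T - s)) `^ (beta + 1) - 1)^-1.

Let rateE s : rate s = (kappa * profile (T - s))^-1.
Proof. by rewrite kappa_profile. Qed.

Lemma is_derive_profile_lag s : s < T ->
  is_derive s 1 (fun s => profile (T - s)) (- (1 + lambda * (T - s)) `^ beta).
Proof.
move=> sT; have d1 : is_derive s 1 (fun s => T - s) (- 1).
  by apply: is_derive_eq; ring.
have d2 : is_derive (T - s) 1 profile ((1 + lambda * (T - s)) `^ beta).
  have := @is_derive_profile R alpha lambda mu alpha_gt1 lambda_gt0 mu_gt0 0 (T - s).
  rewrite subr0 => /(_ (lag0 sT)).
  by under eq_fun do rewrite subr0.
have := @is_derive1_comp _ profile (fun s => T - s) s _ _ d2 d1.
by rewrite mulrN1.
Qed.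

Let continuous_rate s : s < T -> {for s, continuous rate}.
Proof.
move=> sT; rewrite (_ : rate = (fun s => (kappa * profile (T - s))^-1)); last first.
  by apply/funext => r; exact: rateE.
apply: differentiable_continuous; apply/derivable1_diffP.
have d := is_derive_profile_lag sT.
have kp : kappa * profile (T - s) != 0 by rewrite mulf_neq0 ?gt_eqF// prof0.
have d' : is_derive s 1 (fun s => kappa * profile (T - s))
    (kappa * - (1 + lambda * (T - s)) `^ beta).
  by apply: is_derive_eq.
by have [] := @is_deriveV _ (fun s => kappa * profile (T - s)) _ _ _ kp d'.
Qed.

Let integrable_rate t : t < T -> leb.-integrable `[0, t] (EFin \o rate).
Proof.
move=> tT; apply: continuous_compact_integrable; first exact: segment_compact.
apply/subspace_continuousP => s; rewrite /= in_itv/= => /andP[_ st].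
by apply: cvg_within_filter; apply: continuous_rate; exact: le_lt_trans tT.
Qed.

Lemma is_derive_eta t : 0 < t -> t < T ->
  is_derive t 1 eta (kappa * profile (T - t))^-1.
Proof.
move=> t0 tT; have tu : t < (t + T) / 2 by lra.
have uT : (t + T) / 2 < T by lra.
have [d1 d2] := @continuous_FTC1_closed R rate 0 t ((t + T) / 2) tu
  (integrable_rate uT) t0 (continuous_rate tT).
by rewrite -rateE; split; [exact: d1|rewrite -derive1E d2].
Qed.

Lemma continuous_eta t : 0 <= t -> t < T -> {within `[0, t], continuous eta}.
Proof.
by move=> t0 tT; exact: parameterized_integral_continuous t0 (integrable_rate tT).
Qed.

(* Fraction of the goal still to be covered by an agent who never gives up;
   [eta] itself has a junk value at [T], where it should be [+oo]. *)
Definition decay (t : R) : R :=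
  if t < T then expR (- ((mu / (alpha - 1) + lambda) * eta t)) else 0.

Let kappaE : mu / (alpha - 1) + lambda = kappa.
Proof.
rewrite /kappa /growth_exponent mulrDr mulr1; congr (_ + _).
by field; rewrite !gt_eqF.
Qed.

Let decayE t : t < T -> decay t = expR (- (kappa * eta t)).
Proof. by move=> tT; rewrite /decay tT kappaE. Qed.

Lemma decay0 : decay 0 = 1.
Proof. by rewrite /decay T_gt0 /Defs.eta set_itv1 Rintegral_set1 mulr0 oppr0 expR0. Qed.

Lemma decay_gt0 t : t < T -> 0 < decay t.
Proof. by move=> tT; rewrite /decay tT expR_gt0. Qed.

Lemma decay_ge0 t : 0 <= decay t.
Proof. by rewrite /decay; case: ifP => // _; exact: expR_ge0. Qed.

(** An agent who replans at every instant and keeps moving has a distance [d] with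
    [d' = - d / profile (T - t)]. The constant in the exponent of [decay] is [kappa], which cancels
    the one in the derivative of [eta]. *)
Lemma is_derive_decay t : 0 < t -> t < T ->
  is_derive t 1 decay (- (decay t / profile (T - t))).
Proof.
move=> t0 tT; have P0 := prof0 tT.
have d1 : is_derive t 1 (fun s => - (kappa * eta s)) (- (profile (T - t))^-1).
  have d := is_derive_eta t0 tT.
  apply: is_derive_eq; rewrite /GRing.scale/= invfM mulrA divff ?mul1r ?gt_eqF//.
have d2 := is_derive_expR (- (kappa * eta t)).
have := @is_derive1_comp _ expR (fun s => - (kappa * eta s)) t _ _ d2 d1.
rewrite mulrN {2}/decay tT kappaE; apply: near_eq_is_derive.
near=> s; rewrite /decay kappaE; have -> // : s < T.
by near: s; exact: lt_nbhsl.
Unshelve. all: by end_near. Qed.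

Lemma continuous_decay t : 0 <= t -> t < T -> {within `[0, t], continuous decay}.
Proof.
move=> t0 tT; have H : {within `[0, t], continuous (fun s => expR (- (kappa * eta s)))}.
  apply/subspace_continuousP => s sI.
  have /subspace_continuousP/(_ s sI) c := continuous_eta t0 tT.
  apply: continuous_cvg; first exact: continuous_expR.
  by apply: cvgN; apply: cvgMl_tmp; exact: c.
apply: (@subspace_eq_continuous _ _ _ (fun s => expR (- (kappa * eta s)))) => //.
move=> s /set_mem; rewrite /= in_itv/= => /andP[_ st].
exact/esym/decayE/(le_lt_trans st tT).
Qed.

Let decay_noninc_lt s t : 0 <= s -> s <= t -> t < T -> decay t <= decay s.
Proof.
move=> s0 st tT; have t0 := le_trans s0 st.
apply: (@ler0_derive1_le_cc _ decay 0 t).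
- move=> r; rewrite in_itv/= => /andP[r0 rt].
  by have [] := is_derive_decay r0 (lt_trans rt tT).
- move=> r; rewrite in_itv/= => /andP[r0 rt]; rewrite derive1E.
  have [_ ->] := is_derive_decay r0 (lt_trans rt tT).
  by rewrite oppr_le0 divr_ge0 ?decay_ge0// ltW// prof0// (lt_trans rt).
- exact: continuous_decay.
- by rewrite in_itv/= t0 lexx.
- by rewrite in_itv/= s0.
- exact: st.
Qed.

Lemma decay_nonincreasing s t : 0 <= s -> s <= t -> decay t <= decay s.
Proof.
move=> s0 st; have [tT|Tt] := ltP t T; first exact: decay_noninc_lt.
by rewrite {1}/decay ltNge Tt /= decay_ge0.
Qed.

Let C0 := expR (kappa * T) / profile T.

(** The speed [decay t / profile (T - t)] has the form 0/0 at [T]; this bound keeps it finite and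
    makes [decay] Lipschitz up to [T]. *)
Lemma decay_le_profile t : 0 <= t -> t < T -> decay t <= C0 * profile (T - t).
Proof.
(* The exponential factor is chosen so that the derivative of [N] has the sign of
   [u^beta - u^(beta + 1)], where [u = 1 + lambda * (T - s)] is at least [1]. *)
move=> t0 tT; pose N s := decay s * expR (- (kappa * s)) * (profile (T - s))^-1.
have PT : 0 < profile T by rewrite -[T]subr0 prof0.
have N0 : N 0 = (profile T)^-1.
  by rewrite /N decay0 mulr0 oppr0 expR0 !mul1r addr0.
have dN s : 0 < s -> s < T -> is_derive s 1 N
   (decay s * expR (- (kappa * s)) / profile (T - s) ^+ 2 *
     ((1 + lambda * (T - s)) `^ beta - (1 + lambda * (T - s)) `^ (beta + 1))).
  move=> s0 sT; have P0 := prof0 sT.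
  have d1 := is_derive_decay s0 sT.
  have d2 := is_derive_profile_lag sT.
  have d3 : is_derive s 1 (fun s => expR (- (kappa * s))) (- kappa * expR (- (kappa * s))).
    have d31 : is_derive s 1 (fun s => - (kappa * s)) (- kappa).
      by apply: is_derive_eq; rewrite /GRing.scale/= mulr1.
    have := @is_derive1_comp _ expR (fun s => - (kappa * s)) s _ _ (is_derive_expR _) d31.
    by rewrite mulrC.
  have d4 : is_derive s 1 (fun s => (profile (T - s))^-1)
      (profile (T - s) ^- 2 * (1 + lambda * (T - s)) `^ beta).
    have := @is_deriveV _ (fun s => profile (T - s)) _ _ _ (lt0r_neq0 P0) d2.
    by move=> d; apply: is_derive_eq; rewrite /GRing.scale/= mulNr mulrN opprK.
  rewrite /N; apply: is_derive_eq; rewrite /GRing.scale/=.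
  have -> : (1 + lambda * (T - s)) `^ (beta + 1) = kappa * profile (T - s) + 1.
    by rewrite kappa_profile subrK.
  by field; rewrite gt_eqF.
have : N t <= N 0.
  apply: (@ler0_derive1_le_cc _ N 0 t) => //.
  - move=> r; rewrite in_itv/= => /andP[r0 rt].
    by have [] := dN _ r0 (lt_trans rt tT).
  - move=> r; rewrite in_itv/= => /andP[r0 rt]; rewrite derive1E.
    have rT := lt_trans rt tT; have [_ ->] := dN _ r0 rT.
    rewrite mulr_ge0_le0//.
      by rewrite divr_ge0 ?sqr_ge0// mulr_ge0 ?expR_ge0// decay_ge0.
    rewrite subr_le0 ler_powR//; last by rewrite lerDl.
    by rewrite lerDl mulr_ge0 ?(ltW lambda_gt0)// subr_ge0 ltW.
  - apply/subspace_continuousP => s sI; apply: cvgM; first apply: cvgM.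
    + by have /subspace_continuousP/(_ s sI) := continuous_decay t0 tT.
    + apply: cvg_within_filter; apply: continuous_cvg; first exact: continuous_expR.
      by apply: cvgN; apply: cvgMl_tmp; exact: cvg_id.
    + move: sI; rewrite /= in_itv/= => /andP[_ st].
      have sT := le_lt_trans st tT; have d2 := is_derive_profile_lag sT.
      have [dV _] := @is_deriveV _ (fun s => profile (T - s)) _ _ _
        (lt0r_neq0 (prof0 sT)) d2.
      have : {for s, continuous (fun s => (profile (T - s))^-1)}.
        by apply: differentiable_continuous; apply/derivable1_diffP.
      exact: cvg_within_filter.
  - by rewrite in_itv/= t0 lexx.
  - by rewrite in_itv/= lexx t0.
rewrite N0 /N ler_pdivrMr ?prof0// expRN ler_pdivrMr ?expR_gt0//.
move=> H; apply: le_trans H _.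
have -> : C0 * profile (T - t) = (profile T)^-1 * profile (T - t) * expR (kappa * T).
  by rewrite /C0; ring.
rewrite ler_wpM2l//; first by apply: mulr_ge0; rewrite ?invr_ge0 ltW// prof0.
by rewrite ler_expR ler_wpM2l// ltW.
Qed.

Let C0_ge0 : 0 <= C0.
Proof. by rewrite divr_ge0 ?expR_ge0// ltW// -[T]subr0 prof0. Qed.

Let profile_le (w : R) : 0 <= w -> w <= T -> profile w <= (1 + lambda * T) `^ beta * w.
Proof.
move=> w0 wT.
have dP (s : R) : 0 <= s -> is_derive s 1 profile ((1 + lambda * s) `^ beta).
  move=> s0; have := @is_derive_profile R alpha lambda mu alpha_gt1 lambda_gt0 mu_gt0 0 s.
  have ls : 0 < 1 + lambda * s by rewrite ltr_wpDr// mulr_ge0// ltW.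
  rewrite subr0 => /(_ ls).
  by under eq_fun do rewrite subr0.
have [| |s] := @MVT_segment _ profile (fun s => (1 + lambda * s) `^ beta) 0 w w0.
- by move=> s; rewrite in_itv/= => /andP[/ltW s0 _]; exact: dP.
- apply: derivable_within_continuous => s; rewrite in_itv/= => /andP[s0 _].
  by have [] := dP _ s0.
rewrite in_itv/= => /andP[s0 sw]; rewrite profile0 !subr0 => ->.
rewrite ler_wpM2r//; apply: ge0_ler_powR; rewrite ?nnegrE ?(ltW beta0)//.
- by apply: addr_ge0 => //; apply: mulr_ge0 => //; exact: ltW.
- by apply: addr_ge0 => //; apply: mulr_ge0 => //; exact: ltW.
- by rewrite lerD2l ler_pM2l// (le_trans sw).
Qed.

Lemma decay_lipschitz : exists2 L, 0 <= L & forall u v, 0 <= u -> u <= v ->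
  v <= T -> `|decay v - decay u| <= L * (v - u).
Proof.
(* The entry [1] serves [v < T], where [C0] bounds the slope; the other serves [v = T], where
   [decay] is [0] by convention and [profile_le] bounds [decay u] by a multiple of [T - u]. *)
pose L := C0 * Num.max 1 ((1 + lambda * T) `^ beta); exists L.
  by rewrite mulr_ge0// le_max ler01.
move=> u v u0 uv vT; rewrite distrC ger0_norm ?subr_ge0 ?decay_nonincreasing//.
move: vT; rewrite le_eqVlt => /predU1P[vT|vT].
  have vD : decay v = 0 by rewrite /decay vT ltxx.
  rewrite vD subr0; move: uv; rewrite vT le_eqVlt => /predU1P[uT|uT].
    by rewrite /decay uT ltxx subrr mulr0.
  apply: le_trans (decay_le_profile u0 uT) _.
  rewrite /L -[leRHS]mulrA ler_wpM2l//.
  apply: le_trans (profile_le _ _) _; rewrite ?subr_ge0 ?(ltW uT)//.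
    by rewrite lerBlDr lerDl.
  by rewrite ler_wpM2r ?subr_ge0 ?(ltW uT)// le_max lexx orbT.
move: uv; rewrite le_eqVlt => /predU1P[->|uv]; first by rewrite !subrr mulr0.
have [| |s] := @MVT _ decay (fun s => - (decay s / profile (T - s))) u v uv.
- move=> s; rewrite in_itv/= => /andP[us sv].
  by apply: is_derive_decay; [exact: le_lt_trans us|exact: lt_trans vT].
- apply: continuous_subspaceW (continuous_decay (le_trans u0 (ltW uv)) vT).
  by move=> s; rewrite /= !in_itv/= => /andP[us ->]; rewrite (le_trans u0).
rewrite in_itv/= => /andP[us sv] E.
have sT := lt_trans sv vT; have P0 := prof0 sT.
rewrite -opprB E mulNr opprK ler_wpM2r ?subr_ge0 ?(ltW uv)// ler_pdivrMr//.
apply: le_trans (decay_le_profile _ sT) _; first exact: ltW (le_lt_trans u0 us).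
by rewrite ler_wpM2r ?(ltW P0)// /L -[leLHS]mulr1 ler_wpM2l// le_max lexx.
Qed.

(* The threshold is a power of [(u - u `^ (- beta)) / kappa], [u] being
   [1 + lambda * (T - t)]. *)
Lemma threshold_nonincreasing s t : s <= t -> t < T ->
  threshold T alpha lambda mu t <= threshold T alpha lambda mu s.
Proof.
have tE r : r < T -> threshold T alpha lambda mu r =
    (((1 + lambda * (T - r)) - (1 + lambda * (T - r)) `^ (- beta)) / kappa) `^ (alpha - 1).
  move=> rT; rewrite /threshold /hyperbolic_discount.
  rewrite (growth_exponentE lambda mu alpha_gt1) -mulNr powRrM -powRM ?powR_ge0//;
    last exact/ltW/prof0.
  congr (_ `^ _); rewrite /profile mulrAC; congr (_ / _).
  have u0 := lag0 rT; rewrite mulrBl mul1r -powRD ?(gt_eqF u0) ?implybT//.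
  by rewrite (_ : beta + 1 + - beta = 1) ?powRr1 ?(ltW u0)//; ring.
move=> st tT; have sT := le_lt_trans st tT; rewrite (tE _ sT) (tE _ tT).
have u1 r : r < T -> 1 <= 1 + lambda * (T - r).
  by move=> rT; rewrite lerDl mulr_ge0 ?(ltW lambda_gt0)// subr_ge0 ltW.
have pos r : r < T -> 0 <= (1 + lambda * (T - r) - (1 + lambda * (T - r)) `^ (- beta)) / kappa.
  move=> rT; apply: divr_ge0; last exact: ltW.
  rewrite subr_ge0; apply: le_trans (u1 _ rT).
  by rewrite -[leRHS](powRr0 (1 + lambda * (T - r))) ler_powR ?u1// oppr_le0 ltW.
apply: ge0_ler_powR; rewrite ?nnegrE ?pos// ?(ltW a10)//.
rewrite ler_wpM2r ?invr_ge0 ?(ltW kappa0)//.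
have ut : 1 + lambda * (T - t) <= 1 + lambda * (T - s).
  by rewrite lerD2l ler_wpM2l ?(ltW lambda_gt0)// lerB.
rewrite lerB// !powRN lef_pV2 ?posrE ?powR_gt0 ?lag0//.
by apply: ge0_ler_powR; rewrite ?nnegrE ?(ltW beta0) ?(ltW (lag0 _)).
Qed.

Lemma threshold_gt0 t : t < T -> 0 < threshold T alpha lambda mu t.
Proof. by move=> tT; rewrite mulr_gt0 ?powR_gt0 ?prof0 ?lag0. Qed.

Lemma fTE t : t < T ->
  fT T alpha lambda mu t = decay t `^ alpha / threshold T alpha lambda mu t.
Proof.
move=> tT; have P0 := prof0 tT; have u0 := lag0 tT.
rewrite /fT /threshold /hyperbolic_discount kappaE decayE//.
have -> : expR (- (alpha * kappa * eta t)) = expR (- (kappa * eta t)) `^ alpha.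
  by rewrite -expRM; congr expR; ring.
have -> : (mu + lambda * (alpha - 1)) / ((alpha - 1) *
    ((1 + lambda * (T - t)) `^ (beta + 1) - 1)) = (profile (T - t))^-1.
  rewrite -kappa_profile -kappaE; field.
  by rewrite !gt_eqF// addr_gt0// mulr_gt0.
rewrite mulrC powRN; congr (_ * _).
rewrite -powR_inv1 ?(ltW P0)// powRAC powR_inv1 ?powR_ge0//.
by rewrite [RHS]invfM invrK.
Qed.

End decay.

(** * The trajectory with a quitting time *)

Section trajectory.
Context {R : realType}.
Variables (T rew alpha lambda mu theta : R).
Hypotheses (T_gt0 : 0 < T) (rew_gt0 : 0 < rew) (alpha_gt1 : 1 < alpha).
Hypotheses (lambda_gt0 : 0 < lambda) (mu_gt0 : 0 < mu) (theta_ge0 : 0 <= theta).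
Notation gamma := (hyperbolic_discount lambda mu).
Notation profile := (profile alpha lambda mu).
Notation leb := (@lebesgue_measure R).
Notation f := (fT T alpha lambda mu).
Notation decay := (decay T alpha lambda mu).
Notation threshold := (threshold T alpha lambda mu).
Notation rate := (plan_rate T rew alpha lambda mu theta).
Notation follower := (follows_plan T rew alpha gamma theta).

Let a0 : 0 < alpha. Proof. exact: lt_trans alpha_gt1. Qed.
Let prof0 s : s < T -> 0 < profile (T - s).
Proof. by move=> sT; rewrite profile_gt0// subr_gt0. Qed.

Let subr_onem (a b : R) : 1 - a - (1 - b) = - (a - b).
Proof. ring. Qed.

(** Plans are traded for the differential equation that they induce. The endpoints form a null set,
    and [T] has to go because the plan is computed only for [t < T]. *)
Lemma follows_planP (x : R -> R) : follower x <->
  [/\ absolutely_continuous 0 T x, x 0 = 0 &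
    {ae leb, forall t, t \in `]0, T[ -> is_derive t 1 x (rate t (x t))}].
Proof.
split=> -[acx x0 dx]; split => //.
- apply: ae_imp dx _ => t H tI; have tI' := subset_itv_oo_cc tI.
  have [y [v [yv xv]]] := H tI'; move: tI; rewrite in_itv/= => /andP[_ tT].
  by rewrite -(planned_path_rate _ _ _ _ tT yv).
- apply: ae_itv_oo_cc; apply: ae_imp dx _ => t H tI; have xv := H tI.
  move: tI; rewrite in_itv/= => /andP[_ tT].
  have [y yv] := planned_path_exists rew_gt0 alpha_gt1 lambda_gt0 mu_gt0 theta (x t) tT.
  by exists y, (rate t (x t)).
Qed.

Definition quit_times : set R := [set t | (0 <= t < T) && (rew < theta `^ alpha * f t)].

(** Adjoining [T] makes the set nonempty; the value [T] then stands for never giving up. *)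
Definition quit_time : R := inf (quit_times `|` [set T]).

Lemma quit_timesE t : 0 <= t -> t < T ->
  (rew < theta `^ alpha * f t) = (rew * threshold t < (theta * decay t) `^ alpha).
Proof.
move=> t0 tT; rewrite fTE// powRM ?decay_ge0// mulrA ltr_pdivlMr//.
exact: threshold_gt0.
Qed.

Let inf_ok : has_inf (quit_times `|` [set T]).
Proof.
split; first by exists T; right.
by exists 0 => t [/andP[/andP[t0 _] _]|->]//; exact: ltW.
Qed.

Lemma quit_time_ge0 : 0 <= quit_time.
Proof.
apply: lb_le_inf; first exact: inf_ok.1.
by move=> t [/andP[/andP[t0 _] _]|->]//; exact: ltW.
Qed.

Lemma quit_time_leT : quit_time <= T.
Proof. by apply: ge_inf; [exact: inf_ok.2|right]. Qed.

Lemma quit_time_le t : quit_times t -> quit_time <= t.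
Proof. by move=> qt; apply: ge_inf; [exact: inf_ok.2|left]. Qed.

Lemma before_quit_time t : 0 <= t -> t < T -> t < quit_time ->
  theta `^ alpha * f t <= rew.
Proof.
move=> t0 tT; rewrite ltNge => /negP tq; rewrite leNgt; apply/negP => ft.
by apply: tq; apply: quit_time_le; rewrite /quit_times /= t0 tT.
Qed.

(** The infimum need not belong to [quit_times], since the agent may be merely indifferent there;
    times of strict refusal are found arbitrarily soon after it. *)
Lemma after_quit_time t : quit_time < t -> t <= T ->
  exists s, [/\ quit_times s, quit_time <= s & s < t].
Proof.
move=> qt tT; have tq0 : 0 < t - quit_time by rewrite subr_gt0.
have [s [qs|->]] := inf_adherent tq0 inf_ok.
  by rewrite addrC subrK => st; exists s; split => //; exact: quit_time_le.
by rewrite addrC subrK ltNge tT.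
Qed.

Definition trajectory (t : R) : R := theta * (1 - decay (Num.min t quit_time)).

Let decay_le u v : 0 <= u -> u <= v -> decay v <= decay u.
Proof. exact: decay_nonincreasing. Qed.

Lemma follows_plan_trajectory : follower trajectory.
Proof.
have q0 := quit_time_ge0; have qT := quit_time_leT.
apply/follows_planP; split.
- have [L L0 lipL] := decay_lipschitz T_gt0 alpha_gt1 lambda_gt0 mu_gt0.
  apply: (@lipschitz_ac _ _ _ _ (theta * L)); first exact: mulr_ge0.
  move=> u v u0 uv vT.
  have m0 : 0 <= Num.min u quit_time by rewrite le_min u0.
  have muv : Num.min u quit_time <= Num.min v quit_time.
    by rewrite le_min ge_min uv ge_min lexx orbT.
  have mvT : Num.min v quit_time <= T by rewrite ge_min vT.
  have mm : Num.min v quit_time - Num.min u quit_time <= v - u.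
    by case: (leP v quit_time) => ?; case: (leP u quit_time) => ?; lra.
  rewrite /trajectory -mulrBr normrM ger0_norm// -mulrA ler_wpM2l//.
  by rewrite subr_onem normrN; apply: le_trans (lipL _ _ m0 muv mvT) _; rewrite ler_wpM2l.
- by rewrite /trajectory (min_idPl q0) decay0// subrr mulr0.
- apply: ae_imp (ae_neq quit_time) _ => t tq; rewrite in_itv/= => /andP[t0 tT].
  have P0 := prof0 tT.
  have [tlt|tgt|//] := ltgtP t quit_time.
    have xt : theta - trajectory t = theta * decay t.
      by rewrite /trajectory (min_idPl (ltW tlt)); ring.
    have -> : rate t (trajectory t) = theta * (decay t / profile (T - t)).
      have xth : (trajectory t < theta) = (0 < theta).
        rewrite -subr_gt0 xt; apply/idP/idP; last by move=> ?; rewrite mulr_gt0// decay_gt0.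
        move=> th; rewrite lt_neqAle theta_ge0 andbT; apply: contraTneq th => <-.
        by rewrite mul0r ltxx.
      rewrite /plan_rate xth xt leNgt -quit_timesE ?(ltW t0)// -leNgt.
      rewrite before_quit_time ?(ltW t0)// andbT.
      case: ifPn => [_|]; first by rewrite mulrA.
      rewrite -leNgt => th; have -> : theta = 0 by apply/eqP; rewrite eq_le th.
      by rewrite mul0r.
    have d := is_derive_decay alpha_gt1 lambda_gt0 mu_gt0 t0 tT.
    apply: (@near_eq_is_derive _ _ _ (fun s => theta * (1 - decay s))).
      near=> s; rewrite /trajectory; congr (_ * (1 - decay _)); apply/esym/min_idPl.
      by apply: ltW; near: s; exact: lt_nbhsl.
    by apply: is_derive_eq; rewrite /GRing.scale/=; ring.
  have -> : rate t (trajectory t) = 0.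
    rewrite /plan_rate; case: ifPn => // /andP[_].
    have -> : theta - trajectory t = theta * decay quit_time.
      by rewrite /trajectory (min_idPr (ltW tgt)); ring.
    (* The distance left is frozen at [theta * decay quit_time], at least what it would be at the
       refusal time [s] for a persistent agent, while [threshold] has not increased from [s] to
       [t]. *)
    have [s [/andP[/andP[s0 sT] sq] qs st]] := after_quit_time tgt (ltW tT).
    rewrite quit_timesE// in sq.
    suff : rew * threshold t < (theta * decay quit_time) `^ alpha.
      by rewrite ltNge => /negbTE ->.
    apply: (@le_lt_trans _ _ (rew * threshold s)).
      by rewrite ler_pM2l// threshold_nonincreasing// ltW.
    apply: lt_le_trans sq _; apply: ge0_ler_powR.
    - exact: ltW.
    - by rewrite nnegrE mulr_ge0// decay_ge0.
    - by rewrite nnegrE mulr_ge0// decay_ge0.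
    - by apply: (ler_wpM2l theta_ge0); exact: decay_le.
  apply: (@near_eq_is_derive _ _ _ (cst (theta * (1 - decay quit_time)))).
    near=> s; rewrite /trajectory; congr (_ * (1 - decay _)); apply/esym/min_idPr.
    by apply: ltW; near: s; exact: lt_nbhsr.
Unshelve. all: by end_near. Qed.

(** * Comparison of an arbitrary follower with the trajectory *)

Section greatest.
Variable z : R -> R.
Hypothesis z_follows : follower z.

Let acz : absolutely_continuous 0 T z.
Proof. by move/follows_planP : z_follows => []. Qed.
Let z0 : z 0 = 0.
Proof. by move/follows_planP : z_follows => []. Qed.
Let dz : {ae leb, forall t, t \in `]0, T[ -> is_derive t 1 z (rate t (z t))}.
Proof. by move/follows_planP : z_follows => []. Qed.

Lemma follower_le_goal t : t \in `[0, T] -> z t <= theta.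
Proof.
move=> tI; rewrite -subr_ge0.
apply: (@ac_barrier _ 0 T (fun t => theta - z t)) => //.
- exact: (acD (ac_cst 0 T theta) (acN acz)).
- by rewrite z0 subr0.
- apply: ae_imp dz _ => s /[apply] ds; rewrite subr_lt0 => thz.
  exists 0 => //; move: ds; rewrite /plan_rate ltNge (ltW thz) /= => ds.
  by apply: is_derive_eq; rewrite oppr0 mulr0.
Qed.

(** Where [z] is ahead of the persistent agent it has less distance left, so its speed is no
    greater; the gap then has nonnegative derivative and [ac_barrier] applies. *)
Lemma follower_le_persistent t : t \in `[0, T] -> z t <= theta * (1 - decay t).
Proof.
move=> tI; rewrite -subr_ge0.
have [L L0 lipL] := decay_lipschitz T_gt0 alpha_gt1 lambda_gt0 mu_gt0.
apply: (@ac_barrier _ 0 T (fun t => theta * (1 - decay t) - z t)) => //.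
- apply: acD (acN acz); apply: (@lipschitz_ac _ _ _ _ (theta * L)).
    exact: mulr_ge0.
  move=> u v u0 uv vT; rewrite -mulrBr normrM ger0_norm// -mulrA ler_wpM2l//.
  by rewrite subr_onem normrN; exact: lipL.
- by rewrite z0 decay0// subrr mulr0 subr0.
- apply: ae_imp dz _ => s /[swap] /[dup] sI; rewrite in_itv/= => /andP[s0 sT] /(_ sI) ds.
  rewrite subr_lt0 => thz; have P0 := prof0 sT.
  have d := is_derive_decay alpha_gt1 lambda_gt0 mu_gt0 s0 sT.
  exists (theta * (decay s / profile (T - s)) - rate s (z s)); last first.
    by apply: is_derive_eq; rewrite /GRing.scale/=; ring.
  have zth : z s <= theta by apply: follower_le_goal; exact: subset_itv_oo_cc.
  rewrite subr_ge0; apply: (@le_trans _ _ ((theta - z s) / profile (T - s))).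
    rewrite /plan_rate; case: ifP => // _; apply: divr_ge0; last exact: ltW.
    by rewrite subr_ge0.
  rewrite mulrA ler_pM2r ?invr_gt0//; lra.
Qed.

Lemma follower_nondecreasing : {in `[0, T] &, nondecreasing_fun z}.
Proof.
apply: ac_nondecreasing acz _; apply: ae_imp dz _ => s /[swap] /[dup] sI.
rewrite in_itv/= => /andP[s0 sT] /(_ sI) ds; exists (rate s (z s)) => //.
exact: plan_rate_ge0.
Qed.

(** [B] bounds the distances accepted from [s] on, and the distance of [z] at [s] exceeds it
    strictly. If [z] moved later, it would by continuity reach another position still farther than
    [B] from the goal, although its speed is zero almost everywhere until then. *)
Lemma follower_quits s t : quit_times s -> s <= t -> t <= T -> z t = z s.
Proof.
move=> /andP[/andP[s0 sT] sq] st tT; rewrite quit_timesE// in sq.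
have sI : s \in `[0, T] by rewrite in_itv/= s0 ltW.
have tI : t \in `[0, T] by rewrite in_itv/= tT (le_trans s0).
apply/eqP; rewrite eq_le (follower_nondecreasing sI tI st) andbT leNgt.
apply/negP => zst.
pose B := (rew * threshold s) `^ alpha^-1.
have thr0 : 0 <= rew * threshold s by rewrite mulr_ge0 ?ltW// threshold_gt0.
have BE : B `^ alpha = rew * threshold s.
  by rewrite -powRrM mulVf ?gt_eqF// powRr1.
have B0 : 0 <= B by exact: powR_ge0.
have BD : B < theta - z s.
  apply: (@lt_le_trans _ _ (theta * decay s)).
    rewrite ltNge; apply/negP => H; move: sq; rewrite ltNge -BE => /negP; apply.
    apply: ge0_ler_powR => //; first exact: ltW.
    by rewrite nnegrE mulr_ge0// decay_ge0.
  by have := follower_le_persistent sI; lra.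
(* The midpoint keeps [c] above [B]; the maximum with [theta - z t] makes the level [theta - c] one
   that [z] attains on [[s, t]]. *)
pose c := Num.max (theta - z t) ((B + (theta - z s)) / 2).
have cs : c < theta - z s by rewrite gt_max; apply/andP; split; lra.
have Bc : B < c by rewrite lt_max; apply/orP; right; lra.
have tc : theta - c <= z t.
  by rewrite lerBlDr -lerBlDl le_max lexx.
have zc : {within `[s, t], continuous z} by exact/ac_continuous/(acW s0 tT acz).
have [|r] := IVT st zc (v := theta - c).
  by rewrite (min_idPl (ltW zst)) (max_idPr (ltW zst)) tc andbT; lra.
rewrite in_itv/= => /andP[sr rt] zr.
have rT := le_trans rt tT.
have : z s = z r.
  apply: (@ac_constant _ s r z (acW s0 rT acz)); rewrite ?in_itv/= ?lexx ?sr//.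
  apply: ae_imp dz _ => w H; rewrite in_itv/= => /andP[sw wr].
  have w0 := le_lt_trans s0 sw; have wT := lt_le_trans wr rT.
  have := H; rewrite in_itv/= w0 wT => /(_ erefl).
  have -> : rate w (z w) = 0; last by [].
  rewrite /plan_rate; case: ifPn => // /andP[_].
  have zw : z w <= z r.
    by apply: follower_nondecreasing; rewrite ?in_itv/= ?(ltW w0) ?(ltW wT)//
      ?rT ?(le_trans s0 sr)// ltW.
  suff : rew * threshold w < (theta - z w) `^ alpha.
    by rewrite ltNge => /negbTE ->.
  apply: (@le_lt_trans _ _ (B `^ alpha)).
    by rewrite BE ler_pM2l// threshold_nonincreasing// ltW.
  by apply: gt0_ltr_powR => //; rewrite ?nnegrE; lra.
by rewrite zr; lra.
Qed.

Lemma follower_le_trajectory t : t \in `[0, T] -> z t <= trajectory t.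
Proof.
move=> tI; have [tq|qt] := leP t quit_time.
  by rewrite /trajectory (min_idPl tq); exact: follower_le_persistent.
rewrite /trajectory (min_idPr (ltW qt)).
have q0 := quit_time_ge0; move: tI; rewrite in_itv/= => /andP[t0 tT].
have [L L0 lipL] := decay_lipschitz T_gt0 alpha_gt1 lambda_gt0 mu_gt0.
apply/ler_addgt0Pr => e e0.
have tL1 : 0 < theta * L + 1 by rewrite ltr_wpDl// mulr_ge0.
(* As [quit_time] itself may not be a refusal time, [z] is stopped at a refusal time [s] within this
   distance after it, which costs at most [e] since [theta * decay] is Lipschitz with constant
   [theta * L]. *)
have d0 : 0 < e / (theta * L + 1) by rewrite divr_gt0.
have mT : Num.min t (quit_time + e / (theta * L + 1)) <= T by rewrite ge_min tT.
have [|s [sq qs]] := after_quit_time _ mT; first by rewrite lt_min qt ltrDl.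
rewrite lt_min => /andP[st sqe].
rewrite (follower_quits sq (ltW st) tT).
have /andP[/andP[s0 sT] _] := sq.
have sI : s \in `[0, T] by rewrite in_itv/= s0 ltW.
apply: le_trans (follower_le_persistent sI) _.
have := lipL _ _ q0 qs (ltW sT); rewrite ler_norml => /andP[lip _].
move: lip sqe qs; move: quit_time (decay s) (decay quit_time) => q ds dq lip sqe qs.
have : theta * (dq - ds) <= theta * (L * (s - q)).
  by apply: (ler_wpM2l theta_ge0); lra.
have : (theta * L + 1) * (s - q) <= e.
  by rewrite mulrC -ler_pdivlMr// lerBlDl ltW.
lra.
Qed.

End greatest.

Lemma agent_trajectory_trajectory :
  agent_trajectory T rew alpha gamma theta trajectory.
Proof.
split; first exact: follows_plan_trajectory.
by move=> z zf t; exact: follower_le_trajectory.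
Qed.

Lemma agent_trajectoryE x t : agent_trajectory T rew alpha gamma theta x ->
  t \in `[0, T] -> x t = trajectory t.
Proof.
move=> [xf xmax] tI; apply/eqP; rewrite eq_le follower_le_trajectory//=.
by apply: xmax => //; exact: follows_plan_trajectory.
Qed.

End trajectory.

(** * Optimal goals *)

Section shape.
Context {R : realType}.
Variables (T alpha lambda mu x0 : R).
Hypothesis alpha_gt1 : 1 < alpha.
Hypotheses (lambda_gt0 : 0 < lambda) (mu_gt0 : 0 < mu).
Hypothesis x0P : is_x0 alpha lambda mu x0.
Notation profile := (profile alpha lambda mu).
Notation beta := (growth_exponent alpha lambda mu).
Notation eta := (Defs.eta T alpha lambda mu).
Notation f := (fT T alpha lambda mu).
Notation g := (gT T alpha lambda mu).
Notation t0 := (time0 T alpha lambda x0).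
Notation decay := (decay T alpha lambda mu).

Let a0 : 0 < alpha. Proof. exact: lt_trans alpha_gt1. Qed.
Let a10 : 0 < alpha - 1. Proof. by rewrite subr_gt0. Qed.
Let beta0 : 0 < beta. Proof. exact: growth_exponent_gt0. Qed.
Let kappa := lambda * (beta + 1).
Let kappa0 : 0 < kappa. Proof. by rewrite mulr_gt0// addr_gt0. Qed.
Let prof0 s : s < T -> 0 < profile (T - s).
Proof. by move=> sT; rewrite profile_gt0// subr_gt0. Qed.
Let lag0 s : s < T -> 0 < 1 + lambda * (T - s).
Proof. by move=> sT; rewrite addr_gt0// mulr_gt0// subr_gt0. Qed.

Let kappaE : mu / (alpha - 1) + lambda = kappa.
Proof.
rewrite /kappa /growth_exponent mulrDr mulr1; congr (_ + _).
by field; rewrite !gt_eqF.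
Qed.

(** The left-hand side of the equation for [x0] in the variable [u = x^(alpha - 1)]. *)
Let h (u : R) := (alpha - 1) * u `^ (beta + 1) - alpha * (beta + 1) * u + mu / lambda.

Let u0 := x0 `^ (alpha - 1).

Let u0_gt1 : 1 < u0.
Proof.
have [x1 _] := x0P.
have : 1 `^ (alpha - 1) < x0 `^ (alpha - 1).
  by apply: gt0_ltr_powR => //; rewrite nnegrE// ltW// (lt_trans ltr01).
by rewrite powR1.
Qed.

Let h_u0 : h u0 = 0.
Proof.
have [_ <-] := x0P; rewrite /h /u0 -powRrM.
congr (_ * _ `^ _ - _ + _).
by rewrite (growth_exponentE lambda mu alpha_gt1); ring.
Qed.

Let h_1 : h 1 < 0.
Proof.
rewrite /h powR1 (growth_exponentE lambda mu alpha_gt1) /= !mulr1.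
suff -> : alpha - 1 - alpha * (beta + 1) + beta * (alpha - 1) = - (beta + 1).
  by rewrite oppr_lt0 addr_gt0.
by ring.
Qed.

Let h_tangent u v : 0 <= u -> 0 <= v ->
  h u + (beta + 1) * ((alpha - 1) * u `^ beta - alpha) * (v - u) <= h v.
Proof.
move=> u_ge0 v_ge0; have b1 : 1 < beta + 1 by rewrite ltrDr.
have := powR_tangent_le b1 v_ge0 u_ge0; rewrite addrK => H.
have {}H := ler_wpM2l (ltW a10) H.
rewrite -subr_ge0; suff -> : h v -
    (h u + (beta + 1) * ((alpha - 1) * u `^ beta - alpha) * (v - u)) =
    (alpha - 1) * v `^ (beta + 1) -
    (alpha - 1) * (u `^ (beta + 1) + (beta + 1) * u `^ beta * (v - u)).
  by rewrite subr_ge0.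
by rewrite /h; ring.
Qed.

(** The tangent at [u] lies below [h] at both [1] and [u0], where [h] is not positive; whatever the
    sign of its slope, one of these two points gives the bound. *)
Let h_le0 u : 1 <= u -> u <= u0 -> h u <= 0.
Proof.
move=> u1 uu0; have u_ge0 : 0 <= u by exact: le_trans u1.
have := h_tangent u_ge0 ler01; have := h_tangent u_ge0 (ltW (lt_trans ltr01 u0_gt1)).
rewrite h_u0; set d := (beta + 1) * _ => H0 H1.
have [d0|d0] := leP 0 d.
  have : 0 <= d * (u0 - u) by rewrite mulr_ge0// subr_ge0.
  lra.
have : 0 <= d * (1 - u) by rewrite mulr_le0 ?subr_le0// ltW.
by have := h_1; lra.
Qed.

(** The tangent at [u0] vanishes there and is at most [h 1 < 0] at [1], so its slope is
    nonnegative. *)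
Let h_ge0 u : u0 <= u -> 0 <= h u.
Proof.
move=> uu0; have u00 : 0 <= u0 by rewrite ltW// (lt_trans ltr01 u0_gt1).
have := h_tangent u00 ler01; have := h_tangent u00 (le_trans u00 uu0).
rewrite h_u0 !add0r; set d := (beta + 1) * _ => Hu H1.
have d0 : 0 <= d.
  rewrite leNgt; apply/negP => dn; have : 0 <= d * (1 - u0).
    by rewrite mulr_le0 ?subr_le0// ltW.
  by have := h_1; lra.
have : 0 <= d * (u - u0) by rewrite mulr_ge0// subr_ge0.
lra.
Qed.

Let F t := - (alpha * kappa) * eta t - (alpha - 1) * ln (profile (T - t))
  + mu / lambda * ln (1 + lambda * (T - t)).

Let fE t : t < T -> f t = expR (F t).
Proof.
move=> tT; have P0 := prof0 tT; have l0 := lag0 tT.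
rewrite fTE// /threshold /hyperbolic_discount /decay tT kappaE -expRM powRN invfM invrK.
rewrite /F !expRD -[(_ `^ _)^-1]lnK ?posrE ?invr_gt0 ?powR_gt0//.
rewrite -[_ `^ (mu / lambda)]lnK ?posrE ?powR_gt0// lnV ?posrE ?powR_gt0// !ln_powR.
by rewrite mulrA; congr (expR _ * _ * _); ring.
Qed.

Lemma fT_gt0 t : t < T -> 0 < f t.
Proof. by move=> tT; rewrite fE// expR_gt0. Qed.

Let is_derive_F t : 0 < t -> t < T -> is_derive t 1 F
  (h (1 + lambda * (T - t)) /
    ((beta + 1) * (1 + lambda * (T - t)) * profile (T - t))).
Proof.
move=> t_gt0 tT; have P0 := prof0 tT; have l0 := lag0 tT.
have d1 := is_derive_eta alpha_gt1 lambda_gt0 mu_gt0 t_gt0 tT.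
have d2 := @is_derive1_comp _ (@ln R) (fun s => profile (T - s)) t _ _
  (is_derive1_ln P0) (is_derive_profile_lag alpha_gt1 lambda_gt0 mu_gt0 tT).
have d31 : is_derive t 1 (fun s => 1 + lambda * (T - s)) (- lambda).
  by apply: is_derive_eq; rewrite /GRing.scale/=; ring.
have d3 := @is_derive1_comp _ (@ln R) (fun s => 1 + lambda * (T - s)) t _ _
  (is_derive1_ln l0) d31.
rewrite /F; apply: is_derive_eq; rewrite /GRing.scale/= -/kappa /h.
have E : (1 + lambda * (T - t)) `^ (beta + 1) =
    (1 + lambda * (T - t)) * (1 + lambda * (T - t)) `^ beta.
  by rewrite powRD ?(gt_eqF l0) ?implybT// powRr1 ?(ltW l0)// mulrC.
have PE : profile (T - t) =
   ((1 + lambda * (T - t)) * (1 + lambda * (T - t)) `^ beta - 1) / kappa.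
  by rewrite -E /profile.
have muE : mu = lambda * (beta * (alpha - 1)).
  by rewrite -(growth_exponentE lambda mu alpha_gt1) mulrC divfK ?gt_eqF.
have Q0 : (1 + lambda * (T - t)) * (1 + lambda * (T - t)) `^ beta - 1 != 0.
  by apply: contraTneq P0 => Q; rewrite PE Q mul0r ltxx.
rewrite E PE (growth_exponentE lambda mu alpha_gt1) /kappa.
move: Q0 l0; set u := 1 + lambda * (T - t); set w := u `^ beta => Q0 l0.
have b10 : beta + 1 != 0 by rewrite gt_eqF// addr_gt0.
have l00 : lambda != 0 by rewrite gt_eqF.
have u00 : u != 0 by rewrite gt_eqF.
field; by rewrite ?Q0 ?b10 ?l00 ?u00.
Qed.

Let den_gt0 t : t < T ->
  0 < (beta + 1) * (1 + lambda * (T - t)) * profile (T - t).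
Proof.
move=> tT; apply: mulr_gt0; last exact: prof0.
by apply: mulr_gt0; [exact: addr_gt0|exact: lag0].
Qed.

Let continuous_F t : 0 <= t -> t < T -> {within `[0, t], continuous F}.
Proof.
move=> t_ge0 tT.
apply/subspace_continuousP => s sI.
have /subspace_continuousP/(_ s sI) c := continuous_eta alpha_gt1 lambda_gt0 mu_gt0 t_ge0 tT.
move: (sI); rewrite /= in_itv/= => /andP[_ st]; have sT := le_lt_trans st tT.
have P0 := prof0 sT; have l0 := lag0 sT.
apply: cvgD; first apply: cvgB.
- by apply: cvgMl_tmp; exact: c.
- apply: cvgMl_tmp; apply: continuous_cvg; first exact: continuous_ln.
  have : {for s, continuous (fun s => profile (T - s))}.
    apply: differentiable_continuous; apply/derivable1_diffP.
    by have [] := is_derive_profile_lag alpha_gt1 lambda_gt0 mu_gt0 sT.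
  exact: cvg_within_filter.
- apply: cvgMl_tmp; apply: continuous_cvg; first exact: continuous_ln.
  apply: cvg_within_filter; apply: cvgD; first exact: cvg_cst.
  by apply: cvgMl_tmp; apply: cvgB; [exact: cvg_cst|exact: cvg_id].
Qed.

Let lag_t0 : 1 + lambda * (T - t0) = u0.
Proof. by rewrite /time0 -/u0; field; rewrite gt_eqF. Qed.

Lemma time0_lt : t0 < T.
Proof. by rewrite /time0 gtrBl divr_gt0// subr_gt0. Qed.

Lemma fT_nondecreasing s t : 0 <= s -> s <= t -> t <= t0 -> f s <= f t.
Proof.
move=> s_ge0 st tt0; have tT := le_lt_trans tt0 time0_lt.
have t_ge0 := le_trans s_ge0 st.
rewrite !fE// ?(le_lt_trans st)// ler_expR.
apply: (@ger0_derive1_le_cc _ F 0 t).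
- move=> r; rewrite in_itv/= => /andP[r0 rt].
  by have [] := is_derive_F r0 (lt_trans rt tT).
- move=> r; rewrite in_itv/= => /andP[r0 rt]; rewrite derive1E.
  have rT := lt_trans rt tT; have [_ ->] := is_derive_F r0 rT.
  rewrite divr_ge0//.
    apply: h_ge0; rewrite -lag_t0 lerD2l ler_pM2l// lerB//.
    exact: le_trans (ltW rt) tt0.
  exact/ltW/den_gt0.
- exact: continuous_F.
- by rewrite in_itv/= s_ge0.
- by rewrite in_itv/= t_ge0 lexx.
- exact: st.
Qed.

Lemma fT_nonincreasing s t : 0 <= s -> t0 <= s -> s <= t -> t < T -> f t <= f s.
Proof.
move=> s_ge0 t0s st tT; have t_ge0 := le_trans s_ge0 st.
rewrite !fE// ?(le_lt_trans st)// ler_expR.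
apply: (@ler0_derive1_le_cc _ F s t).
- move=> r; rewrite in_itv/= => /andP[sr rt].
  by have [] := is_derive_F (le_lt_trans s_ge0 sr) (lt_trans rt tT).
- move=> r; rewrite in_itv/= => /andP[sr rt]; rewrite derive1E.
  have rT := lt_trans rt tT; have [_ ->] := is_derive_F (le_lt_trans s_ge0 sr) rT.
  rewrite mulr_le0_ge0//.
    apply: h_le0.
      by rewrite lerDl mulr_ge0 ?(ltW lambda_gt0)// subr_ge0 ltW.
    by rewrite -lag_t0 lerD2l ler_pM2l// lerB// (le_trans t0s)// ltW.
  by rewrite invr_ge0; exact/ltW/den_gt0.
- apply: continuous_subspaceW (continuous_F t_ge0 tT).
  by move=> r; rewrite /= !in_itv/= => /andP[sr ->]; rewrite (le_trans s_ge0).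
- by rewrite in_itv/= st lexx.
- by rewrite in_itv/= lexx.
- exact: st.
Qed.

(** [m] is the larger of [0] and [t0], so that both signs of [t0] are treated at once. *)
Lemma fT_le_max t m : 0 <= m -> t0 <= m -> (m = 0 \/ m = t0) ->
  0 <= t -> t < T -> f t <= f m.
Proof.
move=> m0 t0m mE t_ge0 tT; have [mt|tm] := leP m t; first exact: fT_nonincreasing.
case: mE => mE.
  by exfalso; have := le_lt_trans t_ge0 tm; rewrite mE ltxx.
apply: (fT_nondecreasing t_ge0 (ltW tm)); by rewrite mE lexx.
Qed.

Lemma continuous_fT t : 0 <= t -> t < T -> {within `[0, t], continuous f}.
Proof.
move=> t_ge0 tT; have H : {within `[0, t], continuous (expR \o F)}.
  apply/subspace_continuousP => s sI.
  apply: continuous_cvg; first exact: continuous_expR.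
  by have /subspace_continuousP/(_ s sI) := continuous_F t_ge0 tT.
apply: (@subspace_eq_continuous _ _ _ (expR \o F)) => //.
move=> s /set_mem; rewrite /= in_itv/= => /andP[_ st].
exact/esym/fE/(le_lt_trans st tT).
Qed.

Lemma gTE t : t < T -> g t = f t `^ (- alpha^-1) * (1 - decay t).
Proof. by move=> tT; rewrite /gT /decay tT. Qed.

Lemma continuous_gT t : 0 <= t -> t < T -> {within `[0, t], continuous g}.
Proof.
move=> t_ge0 tT.
have H : {within `[0, t], continuous (fun s => f s `^ (- alpha^-1) * (1 - decay s))}.
  apply/subspace_continuousP => s sI.
  have sT : s < T by move: sI; rewrite /= in_itv/= => /andP[_ /le_lt_trans]; apply.
  apply: cvgM.
    have c : f r @[r --> within `[0, t] (nbhs s)] --> f s.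
      by have /subspace_continuousP/(_ s sI) := continuous_fT t_ge0 tT.
    have cp : {for f s, continuous (@powR R ^~ (- alpha^-1))}.
      apply: differentiable_continuous; apply/derivable1_diffP.
      by apply: derivable_powR; rewrite in_itv/= fT_gt0.
    exact: (cvg_comp _ _ c cp).
  apply: cvgB; first exact: cvg_cst.
  by have /subspace_continuousP/(_ s sI) :=
    continuous_decay alpha_gt1 lambda_gt0 mu_gt0 t_ge0 tT.
apply: (subspace_eq_continuous _ H).
move=> s /set_mem; rewrite /= in_itv/= => /andP[_ st].
exact/esym/gTE/(le_lt_trans st tT).
Qed.

End shape.

(** * Final progress as a function of the goal *)

Section final_progress.
Context {R : realType}.
Variables (T rew alpha lambda mu x0 : R).
Hypotheses (T_gt0 : 0 < T) (rew_gt0 : 0 < rew) (alpha_gt1 : 1 < alpha).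
Hypotheses (lambda_gt0 : 0 < lambda) (mu_gt0 : 0 < mu).
Hypothesis x0P : is_x0 alpha lambda mu x0.
Notation f := (fT T alpha lambda mu).
Notation g := (gT T alpha lambda mu).
Notation decay := (decay T alpha lambda mu).
Notation quit_time := (quit_time T rew alpha lambda mu).
Notation trajectory := (trajectory T rew alpha lambda mu).

(* The goal at which the agent becomes indifferent at time [t]. *)
Definition critical_goal (t : R) : R := rew `^ alpha^-1 * f t `^ (- alpha^-1).

Let a0 : 0 < alpha. Proof. exact: lt_trans alpha_gt1. Qed.
Let ai : alpha != 0. Proof. by rewrite gt_eqF. Qed.
Let f0 t : t < T -> 0 < f t.
Proof. exact: fT_gt0. Qed.

Lemma critical_goal_gt0 t : t < T -> 0 < critical_goal t.
Proof. by move=> tT; rewrite mulr_gt0 ?powR_gt0 ?f0. Qed.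

Lemma critical_goal_powR t : t < T -> critical_goal t `^ alpha * f t = rew.
Proof.
move=> tT; rewrite /critical_goal powRM ?powR_ge0// -!powRrM mulNr mulVf//.
by rewrite powRr1 ?(ltW rew_gt0)// powR_inv1 ?(ltW (f0 tT))// divfK// gt_eqF ?f0.
Qed.

Lemma critical_goal_unique theta t : 0 <= theta -> t < T ->
  theta `^ alpha * f t = rew -> theta = critical_goal t.
Proof.
move=> th0 tT E; apply: (@powR_injective _ alpha a0).
- by rewrite nnegrE.
- by rewrite nnegrE ltW// critical_goal_gt0.
- by apply: (mulIf (lt0r_neq0 (f0 tT))); rewrite E critical_goal_powR.
Qed.

Lemma critical_goal_le theta t : 0 <= theta -> t < T ->
  (theta `^ alpha * f t <= rew) = (theta <= critical_goal t).
Proof.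
move=> th0 tT; rewrite -[X in _ <= X](critical_goal_powR tT) ler_pM2r ?f0//.
have c0 := ltW (critical_goal_gt0 tT).
apply/idP/idP => [|H]; last by apply: ge0_ler_powR; rewrite ?nnegrE// ltW.
apply: contraTT; rewrite -!ltNge => H.
by apply: gt0_ltr_powR; rewrite ?nnegrE.
Qed.

Lemma trajectory_end theta :
  trajectory theta T = theta * (1 - decay (quit_time theta)).
Proof. by rewrite /trajectory (min_idPr (quit_time_leT rew alpha lambda mu theta T_gt0)). Qed.

Section goal.
Variable theta : R.
Hypothesis theta_ge0 : 0 <= theta.
Notation q := (quit_time theta).

Let q0 : 0 <= q. Proof. exact: quit_time_ge0. Qed.

Lemma trajectory_end_le_goal : trajectory theta T <= theta.
Proof.
rewrite trajectory_end -[leRHS]mulr1; apply: (ler_wpM2l theta_ge0).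
by rewrite gerBl decay_ge0.
Qed.

Lemma trajectory_end_reached :
  (forall t, 0 <= t -> t < T -> theta `^ alpha * f t <= rew) ->
  trajectory theta T = theta.
Proof.
move=> H; have qT : q = T.
  apply/eqP; rewrite eq_le quit_time_leT//= leNgt; apply/negP => /after_quit_time.
  move=> /(_ T_gt0 (lexx T))[s [/andP[/andP[s0 sT]]]].
  by rewrite ltNge H.
by rewrite trajectory_end qT /decay ltxx subr0 mulr1.
Qed.

(** Quitting at time [0] is kept apart because indifference may fail there: a goal far too large is
    refused outright. *)
Lemma trajectory_end_stuck : q <= 0 -> trajectory theta T = 0.
Proof.
move=> qle; have -> : trajectory theta T = theta * (1 - decay 0).
  by rewrite trajectory_end; congr (_ * (1 - decay _)); apply/eqP; rewrite eq_le qle q0.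
by rewrite decay0// subrr mulr0.
Qed.

(** Before [q] the agent accepts, and refusals accumulate just after it; continuity of [f] turns
    this into equality at [q]. The midpoint of [q] and [T] keeps the argument away from [T], where
    [eta] is singular. *)
Lemma quit_time_indifference : 0 < q -> q < T -> theta `^ alpha * f q = rew.
Proof.
move=> qgt qT; set phi := fun t => theta `^ alpha * f t.
have uT : (q + T) / 2 < T by lra.
have qu : q < (q + T) / 2 by lra.
have u0 : 0 <= (q + T) / 2 by exact: le_trans q0 (ltW qu).
have c : {within `[0, (q + T) / 2], continuous f}.
  exact: continuous_fT.
have close e : 0 < e -> exists2 d, 0 < d & forall s, 0 <= s -> s < (q + T) / 2 ->
    `|q - s| < d -> `|phi q - phi s| < e.
  move=> e0; have qI : `[0, (q + T) / 2]%classic q by rewrite /= in_itv/= q0 ltW.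
  have : phi s @[s --> within `[0, (q + T) / 2] (nbhs q)] --> phi q.
    by apply: cvgMl_tmp; have /subspace_continuousP/(_ q qI) := c.
  move=> /cvgrPdist_lt/(_ e e0); rewrite near_withinE => /nbhs_ballP[d d0 H].
  by exists d => // s s0 su sd; apply: H => //=; rewrite in_itv/= s0 ltW.
apply/eqP; rewrite eq_le; apply/andP; split; rewrite leNgt; apply/negP => lt.
- have [|d d0 H] := close (phi q - rew); first by rewrite subr_gt0.
  pose s := Num.max 0 (q - d / 2).
  have s0 : 0 <= s by rewrite le_max lexx.
  have sq : s < q by rewrite gt_max qgt; lra.
  have := H s s0 (lt_trans sq qu).
  have -> : `|q - s| < d.
    have : q - d / 2 <= s by rewrite le_max lexx orbT.
    by rewrite ger0_norm ?subr_ge0 ?(ltW sq)//; lra.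
  move=> /(_ erefl) /(le_lt_trans (ler_norm _)); rewrite ltrD2l ltrN2.
  have := before_quit_time T_gt0 s0 (lt_trans sq qT) sq.
  by move=> /le_lt_trans H' /H'; rewrite ltxx.
- have [|d d0 H] := close (rew - phi q); first by rewrite subr_gt0.
  have tT : Num.min ((q + T) / 2) (q + d) <= T by rewrite ge_min (ltW uT).
  have qmin : q < Num.min ((q + T) / 2) (q + d) by rewrite lt_min qu ltrDl.
  have [s [/andP[/andP[s0 sT] sr] qs]] := after_quit_time T_gt0 qmin tT.
  rewrite lt_min => /andP[su sd]; have := H s s0 su.
  have -> : `|q - s| < d by rewrite distrC ger0_norm ?subr_ge0// ltrBlDl.
  move=> /(_ erefl); rewrite ltr_norml opprB => /andP[+ _].
  by rewrite ltrD2l ltrN2 => /(lt_trans sr); rewrite ltxx.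
Qed.

(** Origin of [g]: indifference at [q] determines the goal, so the progress depends on [q] alone. *)
Lemma trajectory_end_abandoned : 0 < q -> q < T ->
  trajectory theta T = rew `^ alpha^-1 * g q.
Proof.
move=> qgt qT; rewrite trajectory_end gTE// mulrA -/(critical_goal q).
congr (_ * _); apply: critical_goal_unique => //; exact: quit_time_indifference.
Qed.

End goal.

Section peak.
(* [m] is [0] or [time0]. *)
Variable m : R.
Hypotheses (m0 : 0 <= m) (mT : m < T).
Hypothesis fm : forall t, 0 <= t -> t < T -> f t <= f m.

Lemma goal_below_peak theta : 0 <= theta -> theta <= critical_goal m ->
  trajectory theta T = theta.
Proof.
move=> th0 thm; apply: trajectory_end_reached => // t t0 tT.
apply: (@le_trans _ _ (theta `^ alpha * f m)).
  by apply: (ler_wpM2l (powR_ge0 _ _)); exact: fm.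
by rewrite critical_goal_le.
Qed.

Lemma goal_above_peak theta : 0 <= theta -> critical_goal m < theta ->
  quit_time theta <= m.
Proof.
move=> th0; rewrite ltNge -critical_goal_le// -ltNge => H.
by apply: quit_time_le => //; rewrite /quit_times /= m0 mT.
Qed.

(** The upper bound behind all three cases: [c] is [critical_goal m] when the best goal is reached,
    and the progress given by the maximum of [g] when it is not. For [m = 0] the condition on [s] is
    vacuous. *)
Lemma peak_progress theta c : 0 <= theta -> critical_goal m <= c ->
  (forall s, 0 < s -> s <= m -> rew `^ alpha^-1 * g s <= c) ->
  trajectory theta T <= c.
Proof.
move=> th0 mc gc; have [thm|mth] := leP theta (critical_goal m).
  exact: le_trans (trajectory_end_le_goal th0) (le_trans thm mc).
have qm := goal_above_peak th0 mth.
have [qle|qgt] := leP (quit_time theta) 0.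
  rewrite trajectory_end_stuck//; apply: le_trans mc.
  exact/ltW/critical_goal_gt0.
rewrite trajectory_end_abandoned//; first exact: gc.
exact: le_lt_trans mT.
Qed.

End peak.

Notation t0 := (time0 T alpha lambda x0).

Let t0T : t0 < T. Proof. exact: time0_lt x0P. Qed.

Lemma argmax_gT_exists : 0 < t0 -> exists tau, is_argmax `[0, t0] g tau.
Proof.
move=> t0_gt0; have c : {within `[0, t0], continuous g}.
  by apply: continuous_gT => //; exact: ltW.
have [tau tI H] := EVT_max (ltW t0_gt0) c.
by exists tau; split.
Qed.

Let r0 : 0 < rew `^ alpha^-1. Proof. exact: powR_gt0. Qed.

(** Since [f] is only known to be nondecreasing in the weak sense, quitting may occur after [tau].
    By then the agent has covered at least what he had at [tau]; and as he quits no later than [t0],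
    maximality of [g tau] gives the converse bound. *)
Lemma exploitative_goal_progress tau : 0 < t0 -> is_argmax `[0, t0] g tau ->
  f t0 `^ (- alpha^-1) < g tau ->
  trajectory (critical_goal tau) T = rew `^ alpha^-1 * g tau.
Proof.
move=> t0_gt0 [+ gmax] gtau; rewrite /= in_itv/= => /andP[tau0 taut0].
have tauT := le_lt_trans taut0 t0T.
have th0 := ltW (critical_goal_gt0 tauT).
have gtau_le : g tau <= f tau `^ (- alpha^-1).
  rewrite gTE// -[leRHS]mulr1 ler_wpM2l ?powR_ge0//.
  by rewrite gerBl decay_ge0.
have mth : critical_goal t0 < critical_goal tau.
  by rewrite ltr_pM2l//; exact: lt_le_trans gtau_le.
have qt0 := goal_above_peak (ltW t0_gt0) t0T th0 mth.
have tauq : tau <= quit_time (critical_goal tau).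
  rewrite leNgt; apply/negP => /(after_quit_time T_gt0)/(_ (ltW tauT)).
  move=> [s [/andP[/andP[s0 sT] sr] _ stau]].
  move: sr; rewrite -[X in X < _](critical_goal_powR tauT).
  rewrite ltr_pM2l ?powR_gt0 ?critical_goal_gt0// ltNge.
  by rewrite (fT_nondecreasing alpha_gt1 lambda_gt0 mu_gt0 x0P s0 (ltW stau) taut0).
have qT := le_lt_trans qt0 t0T.
(* Quitting at [0] would force [tau = 0], where [g] vanishes, against [gtau]. *)
have [qle|qgt] := leP (quit_time (critical_goal tau)) 0.
  exfalso; move: gtau.
  have tau_eq0 : tau = 0 by apply/eqP; rewrite eq_le tau0 andbT (le_trans tauq).
  by rewrite tau_eq0 gTE// decay0// subrr mulr0 ltNge powR_ge0.
apply/eqP; rewrite eq_le; apply/andP; split.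
  rewrite (trajectory_end_abandoned th0 qgt qT); apply: (ler_wpM2l (ltW r0)).
  by apply: gmax; rewrite /= in_itv/= qt0 andbT; exact: ltW.
rewrite trajectory_end gTE// mulrA -/(critical_goal tau); apply: (ler_wpM2l th0).
rewrite lerD2l lerN2; exact: decay_nonincreasing tau0 tauq.
Qed.

End final_progress.

(** The first two conjuncts guarantee that the third is not vacuous: trajectories for all goals and
    a maximizer [tau] do exist. *)
Theorem theorem9 (R : realType) (T rew alpha lambda mu x0 : R)
    (T_gt0 : 0 < T) (rew_gt0 : 0 < rew) (alpha_gt1 : 1 < alpha)
    (lambda_gt0 : 0 < lambda) (mu_gt0 : 0 < mu)
    (x0P : is_x0 alpha lambda mu x0) :
  let gamma := hyperbolic_discount lambda mu in
  let t0 := time0 T alpha lambda x0 in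
  let f := fT T alpha lambda mu in
  let g := gT T alpha lambda mu in
  (forall theta : R, 0 <= theta ->
     exists x : R -> R, agent_trajectory T rew alpha gamma theta x) /\
  (0 < t0 -> exists tau : R, is_argmax `[0, t0] g tau) /\
  forall X : R -> R -> R,
    (forall theta : R, 0 <= theta ->
       agent_trajectory T rew alpha gamma theta (X theta)) ->
    [/\ t0 <= 0 ->
          let theta := rew `^ alpha^-1 * f 0 `^ (- alpha^-1) in
          optimal_goal T X theta /\ X theta T = theta,
        forall tau : R, 0 < t0 -> is_argmax `[0, t0] g tau ->
          g tau <= f t0 `^ (- alpha^-1) ->
          let theta := rew `^ alpha^-1 * f t0 `^ (- alpha^-1) in
          optimal_goal T X theta /\ X theta T = theta &
        forall tau : R, 0 < t0 -> is_argmax `[0, t0] g tau ->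
          f t0 `^ (- alpha^-1) < g tau ->
          let theta := rew `^ alpha^-1 * f tau `^ (- alpha^-1) in
          optimal_goal T X theta /\ X theta T = rew `^ alpha^-1 * g tau].
Proof.
move=> gamma t0 f g.
have t0T : t0 < T by exact: time0_lt x0P.
have r0 : 0 < rew `^ alpha^-1 by rewrite powR_gt0.
split=> [theta th0|]; first by eexists; exact: agent_trajectory_trajectory.
split; first exact: argmax_gT_exists x0P.
move=> X HX; have XE theta : 0 <= theta ->
    X theta T = trajectory T rew alpha lambda mu theta T.
  move=> th0; apply: agent_trajectoryE (HX _ th0) _ => //.
  by rewrite in_itv/= lexx ltW.
have gE theta : 0 <= theta -> (forall theta', 0 <= theta' ->
    trajectory T rew alpha lambda mu theta' T <= trajectory T rew alpha lambda mu theta T) ->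
    optimal_goal T X theta.
  move=> th0 H; split; first exact: th0.
  by move=> theta' th0'; rewrite (XE _ th0') (XE _ th0); exact: H.
split.
- move=> t0_le0 theta; have th0 : 0 <= theta by exact/ltW/critical_goal_gt0.
  have peak t : 0 <= t -> t < T -> f t <= f 0.
    exact: (fT_le_max alpha_gt1 lambda_gt0 mu_gt0 x0P (lexx 0) t0_le0
      (or_introl erefl)).
  have end_th : trajectory T rew alpha lambda mu theta T = theta.
    exact: (goal_below_peak T_gt0 rew_gt0 alpha_gt1 lambda_gt0 mu_gt0 T_gt0 peak).
  split; last by rewrite (XE _ th0) end_th.
  apply: (gE _ th0) => theta' th0'; rewrite end_th.
  apply: (peak_progress T_gt0 rew_gt0 alpha_gt1 lambda_gt0 mu_gt0 (lexx 0) T_gt0 th0' (lexx _)).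
  by move=> s s_gt0 /(lt_le_trans s_gt0); rewrite ltxx.
- move=> tau t0_gt0 [_ gmax] gtau theta.
  have th0 : 0 <= theta by exact/ltW/critical_goal_gt0.
  have peak t : 0 <= t -> t < T -> f t <= f t0.
    exact: (fT_le_max alpha_gt1 lambda_gt0 mu_gt0 x0P (ltW t0_gt0) (lexx t0)
      (or_intror erefl)).
  have end_th : trajectory T rew alpha lambda mu theta T = theta.
    exact: (goal_below_peak T_gt0 rew_gt0 alpha_gt1 lambda_gt0 mu_gt0 t0T peak).
  split; last by rewrite (XE _ th0) end_th.
  apply: (gE _ th0) => theta' th0'; rewrite end_th.
  apply: (peak_progress T_gt0 rew_gt0 alpha_gt1 lambda_gt0 mu_gt0 (ltW t0_gt0) t0T th0' (lexx _)).
  move=> s s_gt0 st0; apply: (ler_wpM2l (ltW r0)); apply: le_trans gtau; apply: gmax.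
  by rewrite /= in_itv/= st0 andbT; exact: ltW.
- move=> tau t0_gt0 gargmax gtau theta.
  have [+ gmax] := gargmax; rewrite /= in_itv/= => /andP[tau0 taut0].
  have th0 : 0 <= theta by exact/ltW/critical_goal_gt0/(le_lt_trans taut0).
  have end_th : trajectory T rew alpha lambda mu theta T = rew `^ alpha^-1 * g tau.
    exact: (exploitative_goal_progress T_gt0 rew_gt0 alpha_gt1 lambda_gt0 mu_gt0
      x0P t0_gt0 gargmax gtau).
  split; last by rewrite (XE _ th0) end_th.
  apply: (gE _ th0) => theta' th0'; rewrite end_th.
  apply: (peak_progress T_gt0 rew_gt0 alpha_gt1 lambda_gt0 mu_gt0 (ltW t0_gt0) t0T th0').
    by apply: (ler_wpM2l (ltW r0)); exact: ltW.
  move=> s s_gt0 st0; apply: (ler_wpM2l (ltW r0)); apply: gmax.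
  by rewrite /= in_itv/= st0 andbT; exact: ltW.
Qed.
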